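(* Let $k$ be an odd positive integer. If $G$ is an odd-$(3k-2)$-edge-connected graph or a $(2k-2)$-tree-connected graph, then $G$ can be edge-decomposed into $k$ factors $G_1,\ldots,G_k$ such that for each $i$ and each vertex $v$, $d_{G_i}(v)\equiv d_G(v)\pmod 2$ and $$|d_{G_i}(v)-d_G(v)/k|<2.$$
   Context: Graphs are finite and may have loops and multiple edges; a loop contributes $2$ to the degree $d_G(v)$. For a vertex set $A$, $d_G(A)$ denotes the number of edges with exactly one end in $A$. A graph $G$ is odd-$\lambda$-edge-connected if $d_G(A)\ge\lambda$ for every vertex set $A$ with $d_G(A)$ odd. A graph is $m$-tree-connected if it contains $m$ edge-disjoint spanning trees. A factor is a spanning subgraph; ''edge-decomposed into factors'' means the edge set is partitioned into the edge sets of spanning subgraphs. *)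

(* Defs.v *)
From mathcomp Require Import all_boot all_order all_algebra.

Set Implicit Arguments.
Unset Strict Implicit.
Unset Printing Implicit Defensive.

(* Finite graphs with loops and multiple edges.  The order in which [ends]
   lists the two ends of an edge is immaterial: every notion below is
   invariant under swapping them. *)
Record mgraph := MGraph {
  vertex : finType;
  edge : finType;
  ends : edge -> vertex * vertex }.

(* A loop at v is counted twice. *)
Definition deg (G : mgraph) (v : vertex G) : nat :=
  \sum_(e : edge G) (((ends e).1 == v) + ((ends e).2 == v)).

Definition cut_deg (G : mgraph) (A : {set vertex G}) : nat :=
  #|[set e : edge G | ((ends e).1 \in A) (+) ((ends e).2 \in A)]|.

Definition odd_edge_connected (l : nat) (G : mgraph) : Prop :=
  forall A : {set vertex G}, odd (cut_deg A) -> l <= cut_deg A.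

Definition spanning_subgraph (G : mgraph) (F : {set edge G}) : mgraph :=
  @MGraph (vertex G) {e : edge G | e \in F} (fun e => ends (val e)).

Definition joins (G : mgraph) (e : edge G) (x y : vertex G) : bool :=
  (ends e == (x, y)) || (ends e == (y, x)).

Definition adjacent (G : mgraph) : rel (vertex G) :=
  fun x y => [exists e : edge G, joins e x y].

Definition connected (G : mgraph) : Prop :=
  forall x y : vertex G, connect (@adjacent G) x y.

(* The cycle v_0 e_0 v_1 e_1 ... v_n e_n v_0 is encoded as the sequence of the
   pairs (v_i, e_i); a loop is a cycle of length 1 and two parallel edges form
   a cycle of length 2. *)
Definition graph_cycle (G : mgraph) (c : seq (vertex G * edge G)) : bool :=
  [&& c != [::],
      cycle (fun p q : vertex G * edge G => joins p.2 p.1 q.1) c,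
      uniq (unzip1 c) & uniq (unzip2 c)].

Definition acyclic (G : mgraph) : Prop :=
  forall c : seq (vertex G * edge G), ~~ graph_cycle c.

Definition tree (G : mgraph) : Prop := connected G /\ acyclic G.

Definition tree_connected (m : nat) (G : mgraph) : Prop :=
  exists T : 'I_m -> {set edge G},
    (forall i, tree (spanning_subgraph (T i))) /\
    (forall i j, i != j -> [disjoint T i & T j]).

(* The sets F i partition the edge set; some of them may be empty. *)
Definition edge_decomposition (k : nat) (G : mgraph)
    (F : 'I_k -> {set edge G}) : Prop :=
  (forall i j, i != j -> [disjoint F i & F j]) /\
  \bigcup_(i < k) F i = [set: edge G].

(* Main.v *)
(* A graph all of whose vertices satisfy outdegree = indegree modulo k gives the
   factors at once: split every vertex into an out-part and an in-part, and at
   each part separate a multiple of k arcs from the r remaining ones; k - r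
   dummy edges between the two remainders force them to see the same colours in
   an equitable k-edge-colouring of the resulting bipartite graph.

   The orientation comes from the theorem of Lovasz, Thomassen, Wu and Zhang on
   extending a preorientation of the edges at one vertex z0, proved here modulo
   2k for targets of outdegree minus indegree.  A cut that is as small as
   allowed is contracted from both sides.  Otherwise an edge can be oriented and
   deleted unless every vertex is tight with the same sign; adding up to k - 1
   preoriented edges between z0 and one vertex flips the sign of that vertex.
   Tight vertices of target 0 are first removed by splitting off.

   In both cases of the theorem a minimal cut violating the hypothesis of the
   extension theorem is contracted and the orientation is extended to its
   inside.  If the cut is a single vertex, that vertex is removed by splitting
   off, preserving respectively the odd edge-connectivity (a vertex of even
   degree) and the 2k - 2 disjoint connected classes (a vertex of degree less
   than 3k - 3, whose at least k - 1 remaining edges can meet any target). *)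
Require Import Defs.
From mathcomp Require Import all_boot all_order all_algebra.
From mathcomp Require Import zify lra.
Import Order.TTheory GRing.Theory Num.Theory.

Set Implicit Arguments.
Unset Strict Implicit.
Unset Printing Implicit Defensive.

Lemma sum_subset (V : nmodType) (I : finType) (S' S : {set I}) (F : I -> V) :
  S' \subset S ->
  (\sum_(i in S') F i = \sum_(i in S) if i \in S' then F i else 0)%R.
Proof.
move=> sS'S; rewrite -big_mkcondr; apply: eq_bigl => i.
by case: (boolP (i \in S')) => [/(subsetP sS'S) ->|]; rewrite ?andbF.
Qed.

Lemma sum_pred1 (I : finType) (A : {set I}) (v : I) (b : bool) :
  \sum_(u in A) ((v == u) && b : nat) = (v \in A) && b.
Proof.
case: (boolP (v \in A)) => vA /=.
  rewrite (bigD1 v) //= eqxx big1 ?addn0 // => u /andP[_ uv].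
  by rewrite eq_sym (negbTE uv).
by rewrite big1 // => u uA; case: eqP => // vu; rewrite vu uA in vA.
Qed.

Lemma Posz_sum (J : Type) (r : seq J) (P : pred J) (F : J -> nat) :
  Posz (\sum_(j <- r | P j) F j) = (\sum_(j <- r | P j) (F j)%:Z)%R.
Proof. exact: (big_morph Posz PoszD (erefl _)). Qed.

(** * Orientations modulo 2k *)

Section PartialOrientations.

Variables (T I : finType) (k : nat).
Implicit Types (S : {set I}) (e D : I -> T * T) (A B U : {set T}).
Implicit Types (z : bool -> T -> nat) (c : T -> int).

(* Throughout, U is the set of vertices and S the set of edges still present,
   [z true v] and [z false v] count the edges between v and an outside vertex z0
   that are preoriented out of and into v, and [c v] is the target, modulo 2k,
   of outdegree minus indegree. *)
Definition same_ends (p q : T * T) := (p == q) || (p == (q.2, q.1)).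
Definition crosses A (p : T * T) : bool := (p.1 \in A) (+) (p.2 \in A).
Definition cut S e A : nat := \sum_(i in S) crosses A (e i).
Definition flux A (p : T * T) : int := ((p.1 \in A)%:Z - (p.2 \in A)%:Z)%R.
Definition net S D A : int := (\sum_(i in S) flux A (D i))%R.
Definition zsum (f : T -> nat) A : nat := \sum_(v in A) f v.
Definition csum c A : int := (\sum_(v in A) c v)%R.
Definition wdeg S e z A : nat := cut S e A + zsum (z true) A + zsum (z false) A.
Definition cong (x y : int) := exists j : int, (x = y + j * (2 * k)%:Z)%R.
Definition within U S e := forall i, i \in S -> ((e i).1 \in U) && ((e i).2 \in U).
Definition orients S e D := forall i, i \in S -> same_ends (e i) (D i).
Definition solves U S e z c D :=
  orients S e D /\
  forall v, v \in U ->
    cong (net S D [set v] + (z true v)%:Z - (z false v)%:Z)%R (c v).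
(* Some orientation of a cut with w edges and target x has at least r edges going
   out and at least s coming in; for r = s = k - 1 this is the condition
   w >= 2k - 2 + |tau| of Lovasz et al. *)
Definition good r s (w : nat) (x : int) :=
  exists o i : nat, exists j : int,
    [/\ r <= o, s <= i, o + i = w & (o%:Z - i%:Z = x + j * (2 * k)%:Z)%R].
(* This is d(z0) <= 2k - 2 + |tau(z0)| for a and g preoriented edges. *)
Definition small (a g : nat) := (a < k) && (g < 2 * k) || (g < k) && (a < 2 * k).

Definition goodb r s (w : nat) (x : int) :=
  [exists o : 'I_w.+1,
    [&& r <= o, s <= w - o & ((2 * k)%:Z %| o%:Z - (w - o)%:Z - x)%Z%R]].

Lemma goodP r s w x : reflect (good r s w x) (goodb r s w x).
Proof.
apply: (iffP existsP) => [[o /and3P[h1 h2 /dvdzP[j Hj]]]|[o [i [j [h1 h2 h3 Hj]]]]].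
  by exists (o : nat), (w - o), j; have := ltn_ord o; split; lia.
have ow : o < w.+1 by lia.
exists (Ordinal ow); rewrite /= h1 -h3 addKn h2 /=; apply/dvdzP; exists j; lia.
Qed.

Lemma cong_refl x : cong x x.
Proof. by exists 0%R; lia. Qed.

Lemma cong_sum (J : finType) (A : {set J}) (f g : J -> int) :
  (forall v, v \in A -> cong (f v) (g v)) ->
  cong (\sum_(v in A) f v)%R (\sum_(v in A) g v)%R.
Proof.
move=> fg; apply: (big_ind2 cong) => //; first exact: cong_refl.
by move=> x1 x2 y1 y2 [j Hj] [j' Hj']; exists (j + j')%R; lia.
Qed.

Lemma good_cong r s w x y : cong x y -> good r s w x -> good r s w y.
Proof. by move=> [j Hj] [o [i [j' [? ? ? ?]]]]; exists o, i, (j + j')%R; split => //; lia. Qed.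

Lemma good_add2 t r s w x : good r s w x -> good r s (w + 2 * t) x.
Proof. by move=> [o [i [j' [? ? ? ?]]]]; exists (o + t), (i + t), j'; split => //; lia. Qed.

Lemma same_ends_cross A p q : same_ends p q -> crosses A p = crosses A q.
Proof. by case/orP => /eqP -> //; rewrite /crosses addbC. Qed.

Lemma same_ends_swap p : same_ends p (p.2, p.1).
Proof. by rewrite /same_ends -surjective_pairing eqxx orbT. Qed.

Lemma sum_net S D A : (\sum_(v in A) net S D [set v] = net S D A)%R.
Proof.
rewrite exchange_big; apply: eq_bigr => i _; rewrite /flux big_split /= sumrN.
have E w : (\sum_(v in A) (w \in [set v])%:Z = (w \in A)%:Z)%R.
  have := sum_pred1 A w true; rewrite andbT => <-.
  by rewrite Posz_sum; apply: eq_bigr => v _; rewrite in_set1 andbT.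
by rewrite !E.
Qed.

Lemma zsum1 f v : zsum f [set v] = f v.
Proof. exact: big_set1. Qed.

Lemma csum1 c v : csum c [set v] = c v.
Proof. exact: big_set1. Qed.

End PartialOrientations.

(** * Contraction of tight cuts *)

Section Contraction.

Variables (T I : finType) (k : nat).
Implicit Types (S : {set I}) (e D : I -> T * T) (A B U : {set T}).
Implicit Types (z : bool -> T -> nat) (c : T -> int).

Definition inner S e B := [set i in S | ((e i).1 \in B) && ((e i).2 \in B)].
Definition collapse B (a v : T) := if v \in B then a else v.
Definition collapse_ends B a e : I -> T * T :=
  fun i => (collapse B a (e i).1, collapse B a (e i).2).
Definition collapse_z B a z : bool -> T -> nat :=
  fun d v => if v == a then zsum (z d) B else z d v.
Definition collapse_c B a c : T -> int :=
  fun v => if v == a then csum c B else c v.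

Lemma glue U S e z c B a D1 :
  within U S e -> B \subset U -> a \in B ->
  solves k (a |: (U :\: B)) S (collapse_ends B a e) (collapse_z B a z)
    (collapse_c B a c) D1 ->
  exists z2,
  [/\ forall A, A \subset B -> wdeg (inner S e B) e z2 A = wdeg S e z A,
      cong k ((zsum (z2 true) B)%:Z - (zsum (z2 false) B)%:Z)%R (csum c B) &
      forall D2, solves k B (inner S e B) e z2 c D2 ->
      exists D, solves k U S e z c D].
Proof.
move=> HU sBU aB [oD1 sD1].
pose D0 i := if D1 i == collapse_ends B a e i then e i else ((e i).2, (e i).1).
have oD0 : orients S e D0.
  move=> i iS; rewrite /D0; case: ifP => _; last exact: same_ends_swap.
  by rewrite /same_ends eqxx.
have fD0 i : i \in S -> D1 i = (collapse B a (D0 i).1, collapse B a (D0 i).2).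
  move=> iS; rewrite /D0; case: eqP => // nE.
  by case/orP: (oD1 i iS) => /eqP E; [rewrite E in nE | case: E => /= -> ->; case: (D1 i)].
pose z2 (d : bool) v := z d v +
  \sum_(i in S) (if d then ((D0 i).1 == v) && ((D0 i).2 \notin B)
                 else ((D0 i).2 == v) && ((D0 i).1 \notin B)).
have zs2 d A : zsum (z2 d) A = zsum (z d) A +
  \sum_(i in S) (if d then ((D0 i).1 \in A) && ((D0 i).2 \notin B)
                 else ((D0 i).2 \in A) && ((D0 i).1 \notin B)).
  rewrite /zsum big_split /= exchange_big /=; congr (_ + _).
  by apply: eq_bigr => i _; case: d; rewrite sum_pred1.
have inD0 i : i \in S ->
  (i \in inner S e B) = ((D0 i).1 \in B) && ((D0 i).2 \in B).
  move=> iS; rewrite inE iS /=.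
  by case/orP: (oD0 i iS) => /eqP ->; rewrite //= andbC.
have sS2 : inner S e B \subset S by apply/subsetP => i; rewrite inE => /andP[].
exists z2; split.
- move=> A /subsetP sAB; rewrite /wdeg !zs2.
  suff E : \sum_(i in S) crosses A (e i) =
     \sum_(i in S) (if i \in inner S e B then (crosses A (e i) : nat) else 0)
     + \sum_(i in S) (((D0 i).1 \in A) && ((D0 i).2 \notin B))
     + \sum_(i in S) (((D0 i).2 \in A) && ((D0 i).1 \notin B)).
    have -> : cut (inner S e B) e A =
        \sum_(i in S) (if i \in inner S e B then (crosses A (e i) : nat) else 0).
      by rewrite /cut (sum_subset _ sS2).
    by rewrite [cut S e A]E; lia.
  rewrite -!big_split /=; apply: eq_bigr => i iS.
  rewrite (inD0 i iS) (same_ends_cross A (oD0 i iS)) /crosses.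
  have /implyP := sAB (D0 i).1; have /implyP := sAB (D0 i).2.
  by do 2!case: (_ \in A); do 2!case: (_ \in B).
- have /sD1 : a \in a |: (U :\: B) by rewrite setU11.
  rewrite /collapse_z /collapse_c eqxx => [[j Hj]]; exists j.
  rewrite -Hj !zs2 /net.
  suff -> : (\sum_(i in S) flux [set a] (D1 i) =
     (\sum_(i in S) ((((D0 i).1 \in B) && ((D0 i).2 \notin B)) : nat))%:Z -
     (\sum_(i in S) ((((D0 i).2 \in B) && ((D0 i).1 \notin B)) : nat))%:Z)%R by lia.
  rewrite !Posz_sum -sumrB; apply: eq_bigr => i iS.
  rewrite (fD0 i iS) /flux /= !in_set1 /collapse.
  have nB v : v \notin B -> (v == a) = false by move=> vB; apply: contraNF vB => /eqP->.
  by do 2![case: ifP => [|/negbT]] => H1 H2 /=; rewrite ?eqxx ?(nB _ H1) ?(nB _ H2).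
- move=> D2 [oD2 sD2].
  pose D i := if i \in inner S e B then D2 i else D0 i.
  exists D; split => [i iS|v vU].
    by rewrite /D; case: ifP => [/oD2|_]; last exact: oD0.
  have [vB|vB] := boolP (v \in B).
    have [j Hj] := sD2 v vB; exists j; rewrite -{}Hj /net (sum_subset _ sS2).
    set X := (X in _ = (X + _ - _)%R).
    suff -> : (\sum_(i in S) flux [set v] (D i) = X +
      (z2 true v)%:Z - (z true v)%:Z - (z2 false v)%:Z + (z false v)%:Z)%R by lia.
    rewrite /z2 !PoszD !Posz_sum.
    suff -> : (\sum_(i in S) flux [set v] (D i) = X +
      \sum_(i in S) (((D0 i).1 == v) && ((D0 i).2 \notin B))%:Z -
      \sum_(i in S) (((D0 i).2 == v) && ((D0 i).1 \notin B))%:Z)%R by lia.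
    rewrite /X -big_split -sumrB /=; apply: eq_bigr => i iS.
    rewrite /D inD0 //; case: ifP => [/andP[-> ->]|]; first by rewrite !andbF /=; lia.
    have h w : w == v -> w \in B by move=> /eqP->.
    rewrite /flux !in_set1; move: (h (D0 i).1) (h (D0 i).2).
    by do 2!case: (_ == v); do 2!case: (_ \in B) => //; move=> h1 h2; rewrite ?h1 ?h2.
  have va : (v == a) = false by apply: contraNF vB => /eqP->.
  have /sD1 : v \in a |: (U :\: B) by rewrite !inE vB vU orbT.
  rewrite /collapse_z /collapse_c va => [[j Hj]]; exists j; rewrite -{}Hj.
  congr (_ + _ - _)%R; apply: eq_bigr => i iS; rewrite /D inD0 // (fD0 i iS).
  have fv w : (collapse B a w == v) = (w == v).
    rewrite /collapse; case: ifP => // wB; rewrite eq_sym va.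
    by apply/esym; apply: contraNF vB => /eqP <-.
  case: ifP => [iB|_]; last by rewrite /flux !in_set1 /= !fv.
  have iB' : i \in inner S e B by rewrite inD0.
  have : ((D2 i).1 \in B) && ((D2 i).2 \in B).
    by move: (iB'); rewrite inE => /andP[_]; case/orP: (oD2 i iB') => /eqP -> //=; rewrite andbC.
  move=> /andP[h1 h2]; case/andP: iB => h3 h4; rewrite /flux !in_set1 /= !fv.
  have nv w : w \in B -> (w == v) = false by move=> wB; apply: contraNF vB => /eqP<-.
  by rewrite !nv.
Qed.

Lemma collapse_sum (V : nmodType) U B a A (f : T -> V) :
  A \subset a |: (U :\: B) -> a \in B ->
  (\sum_(v in A) (if v == a then \sum_(u in B) f u else f v) =
   \sum_(v in if a \in A then A :|: B else A) f v)%R.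
Proof.
move=> /subsetP sA aB; case: ifP => aA; last first.
  by apply: eq_bigr => v vA'; case: eqP vA' => // ->; rewrite aA.
rewrite (bigD1 a) //= eqxx (bigID (mem B) (mem (A :|: B))) /=.
congr (_ + _)%R.
  by apply: eq_bigl => v; rewrite inE; case: (v \in B); rewrite ?orbT ?andbF.
apply: eq_big => [v|v /andP[_ /negbTE->]] //.
rewrite inE; case: (eqVneq v a) => [->|va]; first by rewrite aB !andbF.
case: (boolP (v \in A)) => //= vA'; last by case: (v \in B).
by have := sA _ vA'; rewrite !inE (negbTE va) /= => /andP[].
Qed.

Lemma collapse_wdeg U S e z B a A :
  A \subset a |: (U :\: B) -> a \in B ->
  wdeg S (collapse_ends B a e) (collapse_z B a z) A =
  wdeg S e z (if a \in A then A :|: B else A).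
Proof.
move=> sA aB.
have vA w : (collapse B a w \in A) = (w \in (if a \in A then A :|: B else A)).
  rewrite /collapse; case: ifP => wB; case: ifP => aA; rewrite ?inE ?wB ?orbT ?orbF //.
  apply/esym; apply: contraFF aA => wA.
  by have := subsetP sA _ wA; rewrite !inE wB orbF => /eqP <-.
rewrite /wdeg; congr (_ + _ + _); try exact: (collapse_sum _ sA aB).
by apply: eq_bigr => i _; rewrite /crosses /= !vA.
Qed.

Lemma collapse_within U S e B a :
  within U S e -> within (a |: (U :\: B)) S (collapse_ends B a e).
Proof.
move=> HU i /HU /andP[h1 h2]; rewrite /collapse_ends /collapse /=.
by apply/andP; split; case: ifP => [_|/negbT nB]; rewrite !inE ?eqxx // ?nB ?h1 ?h2 ?orbT.
Qed.

End Contraction.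

Section Feasible.

Variables (T I : finType) (k : nat).
Implicit Types (S : {set I}) (e D : I -> T * T) (A B U X : {set T}).
Implicit Types (z : bool -> T -> nat) (c : T -> int).

(* X is empty or a singleton.  Its element x, a vertex of target 0 and even
   degree in the course of being split off, does not count when a cut is tested
   for being trivial. *)
Record feasible X U S e z c : Prop := Feasible {
  fe_within : within U S e;
  fe_small : small k (zsum (z true) U) (zsum (z false) U);
  fe_total : cong k ((zsum (z true) U)%:Z - (zsum (z false) U)%:Z)%R (csum c U);
  fe_good : forall A u v, A \subset U -> v \in A -> v \notin X ->
    u \in U -> u \notin A -> u \notin X ->
    good k k.-1 k.-1 (wdeg S e z A) (csum c A);
  fe_special : forall x, x \in X ->
    [/\ x \in U, X = [set x], cong k (c x) 0 &
        exists h, wdeg S e z [set x] = 2 * h /\ forall d, z d x <= h] }.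

Lemma wdegD1 S e z B x : x \in B ->
  wdeg S e z B + 2 * cut (inner S e B) e [set x] =
  wdeg S e z (B :\ x) + wdeg S e z [set x].
Proof.
move=> xB; rewrite /wdeg !zsum1.
have E d : zsum (z d) B = z d x + zsum (z d) (B :\ x) by rewrite /zsum (big_setD1 x).
rewrite !E.
have -> : cut (inner S e B) e [set x] =
  \sum_(i in S) (if i \in inner S e B then (crosses [set x] (e i) : nat) else 0).
  by rewrite /cut (sum_subset (S := S)) //; apply/subsetP => i; rewrite inE => /andP[].
suff E2 : cut S e B + (\sum_(i in S)
    (if i \in inner S e B then (crosses [set x] (e i) : nat) else 0) +
    \sum_(i in S) (if i \in inner S e B then (crosses [set x] (e i) : nat) else 0)) =
  cut S e (B :\ x) + cut S e [set x] by lia.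
rewrite -!big_split /=; apply: eq_bigr => i iS; rewrite inE iS /crosses !inE.
have h w : w == x -> w \in B by move=> /eqP->.
move: (h (e i).1) (h (e i).2).
by do 2!case: (_ == x); do 2!case: (_ \in B) => //; move=> h1 h2 //; exfalso; auto.
Qed.

Lemma not_good_small o i w x : cong k (o%:Z - i%:Z)%R x -> o + i = w ->
  ~ good k k k w x -> small k o i.
Proof.
move=> [j Hj] Ew ng; apply: contra_notT ng => ns; rewrite /small in ns.
have [h1|h1] := leqP k o; last first.
  exists (o + k), (i - k), (j + 1)%R; split; lia.
have [h2|h2] := leqP k i; first by exists o, i, j; split; lia.
exists (o - k), (i + k), (j - 1)%R; split; lia.
Qed.

(* If x lies in B together with fewer than half of its edges, then the cut of
   B :\ x is violated too; this way x never gets too many preoriented edges. *)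
Lemma reduce X U S e z c B u :
  feasible X U S e z c -> B \subset U -> 1 < #|B :\: X| ->
  u \in U -> u \notin B -> u \notin X ->
  ~ good k k k (wdeg S e z B) (csum c B) ->
  (forall X' U' S' e' z' c', #|U' :\: X'| < #|U :\: X| ->
     feasible X' U' S' e' z' c' -> exists D, solves k U' S' e' z' c' D) ->
  exists D, solves k U S e z c D.
Proof.
move=> F; wlog HX : B / forall x, x \in X -> x \in B ->
    wdeg S e z [set x] <= 2 * cut (inner S e B) e [set x].
  move=> W sBU B1 uU uB uX ng IH.
  have [/forall_inP HX|] := boolP [forall x in X, (x \in B) ==>
      (wdeg S e z [set x] <= 2 * cut (inner S e B) e [set x])].
    by apply: (W B) => // x /HX /implyP.
  rewrite negb_forall_in => /exists_inP[x xX]; rewrite negb_imply -ltnNge => /andP[xB lt].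
  have [xU EX [j Hj] [h [Eh _]]] := fe_special F xX.
  apply: (W (B :\ x)) => //.
  - by move=> y; rewrite EX => /set1P ->; rewrite setD11.
  - exact: subset_trans (subsetDl _ _) sBU.
  - by rewrite EX setDDl setUid -EX.
  - by rewrite !inE negb_and uB orbT.
  move=> g; apply: ng; have E := wdegD1 S e z xB.
  have -> : wdeg S e z B = wdeg S e z (B :\ x) + 2 * (h - cut (inner S e B) e [set x]) by lia.
  apply: good_add2; apply: good_cong g; exists (- j)%R.
  by rewrite [in RHS]/csum (big_setD1 x) //= -/(csum _ _); lia.
move=> sBU B1 uU uB uX ng IH.
have [a aBX] : exists a, a \in B :\: X by apply/set0Pn; rewrite -card_gt0; lia.
have [aX aB] : a \notin X /\ a \in B by apply/andP; move: aBX; rewrite inE.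
set U1 := a |: (U :\: B).
have U1U : (if a \in U1 then U1 :|: B else U1) = U.
  rewrite setU11 /U1 -setUA [in X in a |: X]setUC; apply/setP => v; rewrite !inE.
  case: eqP => [->|_]; first by rewrite (subsetP sBU).
  by case: (boolP (v \in B)) => [/(subsetP sBU) ->|].
have [D1 sol1] : exists D1, solves k U1 S (collapse_ends B a e) (collapse_z B a z)
    (collapse_c B a c) D1.
  apply: (IH (X :\: B)).
    have -> : U1 :\: (X :\: B) = a |: ((U :\: X) :\: (B :\: X)).
      apply/setP => v; rewrite !inE; case: eqP => [->|_]; first by rewrite aB.
      by case: (v \in B); case: (v \in X).
    have s1 : B :\: X \subset U :\: X by apply: setSD.
    have s2 : [set a; u] \subset U :\: X.
      by apply/subsetP => v /set2P [->|->]; rewrite inE ?aX ?uX // (subsetP sBU).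
    rewrite cardsU1 cardsD (setIidPr s1); have := subset_leq_card s1; clear -B1; lia.
  split.
  - exact: collapse_within (fe_within F).
  - by rewrite /zsum !(collapse_sum _ (subxx _) aB) U1U; exact: fe_small F.
  - by rewrite /zsum /csum !(collapse_sum _ (subxx _) aB) U1U; exact: fe_total F.
  - move=> A v' v sA vA vX v'U v'A v'X.
    rewrite (collapse_wdeg _ _ _ sA aB) /csum (collapse_sum _ sA aB).
    set A' := if _ then _ else _.
    have sA' : A' \subset U.
      have sU1 : U1 \subset U by rewrite subUset sub1set (subsetP sBU) // subsetDl.
      by rewrite /A'; case: ifP => _; rewrite ?subUset ?sBU ?andbT (subset_trans sA).
    have [v1 [v1A v1X]] : exists v1, v1 \in A' /\ v1 \notin X.
      rewrite /A'; have := subsetP sA _ vA; rewrite !inE => /orP [/eqP va|/andP[vB vU]].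
        by exists a; rewrite va in vA; rewrite vA inE aB orbT.
      exists v; split; first by case: ifP => _; rewrite ?inE vA.
      by move: vX; rewrite inE vB.
    have [u1 [u1U u1A u1X]] : exists u1, [/\ u1 \in U, u1 \notin A' & u1 \notin X].
      rewrite /A'; move: v'U; rewrite !inE => /orP [/eqP va|/andP[vB vU]].
        by move: v'A; rewrite va => /negbTE aA; exists a; rewrite aA aA aX (subsetP sBU).
      exists v'; split => //; first by case: ifP => _; rewrite ?inE ?negb_or ?v'A ?vB.
      by move: v'X; rewrite inE vB.
    exact (fe_good F sA' v1A v1X u1U u1A u1X).
  - move=> x; rewrite inE => /andP[xB xX].
    have [xU EX cx [h [Eh zh]]] := fe_special F xX.
    have xa : (x == a) = false by apply: contraNF xB => /eqP ->.
    have sx : [set x] \subset U1 by rewrite sub1set !inE xB xU orbT.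
    split.
    + by rewrite !inE xB xU orbT.
    + by apply/setP => w; rewrite EX !inE; case: eqP => [->|]; rewrite ?xB ?andbF.
    + by rewrite /collapse_c xa.
    exists h; rewrite (collapse_wdeg _ _ _ sx aB) inE eq_sym xa; split => // d.
    by rewrite /collapse_z xa.
have [z2 [w2 t2 sol2]] := glue (fe_within F) sBU aB sol1.
have [D2 s2] : exists D2, solves k B (inner S e B) e z2 c D2.
  apply: (IH (X :&: B)).
    have -> : B :\: (X :&: B) = B :\: X.
      by apply/setP => v; rewrite !inE; case: (v \in B); rewrite ?andbT ?andbF.
    apply: proper_card; apply/properP; split; first exact: setSD.
    by exists u; rewrite !inE ?uX ?uU // negb_and uB orbT.
  split => //.
  - by move=> i; rewrite inE => /andP[].
  - apply: not_good_small t2 _ ng; rewrite -(w2 B (subxx _)) /wdeg.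
    rewrite [cut _ _ _]big1 // => i; rewrite inE => /andP[_ /andP[h1 h2]].
    by rewrite /crosses h1 h2.
  - move=> A u' v sA vA vX u'B u'A u'X; rewrite w2 //.
    have sAU := subset_trans sA sBU.
    apply: (fe_good F sAU vA _ _ u'A); rewrite ?(subsetP sBU) //.
      by move: vX; rewrite inE (subsetP sA _ vA) andbT.
    by move: u'X; rewrite inE u'B andbT.
  - move=> x /setIP[xX xB]; have [xU EX cx [h [Eh zh]]] := fe_special F xX.
    split => //.
      by apply/setP => w; rewrite EX !inE; case: eqP => [->|].
    exists h; rewrite w2 ?sub1set //; split => // d.
    have := w2 [set x]; rewrite sub1set xB => /(_ isT).
    have := HX x xX xB; rewrite Eh /wdeg !zsum1.
    by clear; case: d; lia.
exact: sol2 s2.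
Qed.

End Feasible.

(** * Splitting off *)

Section Lifting.

Variables (T I : finType) (k : nat).
Implicit Types (S : {set I}) (e D : I -> T * T) (A B U X : {set T}).
Implicit Types (z : bool -> T -> nat) (c : T -> int).

Definition upd e i p : I -> T * T := fun l => if l == i then p else e l.

Lemma sum_upd (V : nmodType) S e i p (F : T * T -> V) : i \in S ->
  (\sum_(l in S) F (upd e i p l) = F p + \sum_(l in S :\ i) F (e l))%R.
Proof.
move=> iS; rewrite (big_setD1 i) //= /upd eqxx; congr (_ + _)%R.
by apply: eq_bigr => l; rewrite !inE => /andP[/negbTE->].
Qed.

Lemma sum_split2 (V : nmodType) S (i j : I) (F : I -> V) : i \in S -> j \in S -> i != j ->
  (\sum_(l in S) F l = F i + (F j + \sum_(l in S :\ j :\ i) F l))%R.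
Proof.
move=> iS jS ij; rewrite (big_setD1 j) //= (big_setD1 i) ?inE ?ij //=.
by rewrite addrCA.
Qed.

Lemma lift_cut S e i j x y w A : i \in S -> j \in S -> i != j ->
  same_ends (e i) (x, y) -> same_ends (e j) (x, w) ->
  cut S e A = cut (S :\ j) (upd e i (y, w)) A +
    2 * (((x \in A) != (y \in A)) && ((x \in A) != (w \in A))).
Proof.
move=> iS jS ij ei ej.
have -> : cut S e A = crosses A (e i) + (crosses A (e j) +
    \sum_(l in S :\ j :\ i) crosses A (e l)) by rewrite [LHS](sum_split2 _ iS jS ij).
have -> : cut (S :\ j) (upd e i (y, w)) A =
    crosses A (y, w) + \sum_(l in S :\ j :\ i) crosses A (e l).
  by rewrite [LHS](sum_upd e (y, w) (fun p => crosses A p : nat)) // !inE ij.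
rewrite (same_ends_cross A ei) (same_ends_cross A ej) /crosses /=.
by case: (x \in A); case: (y \in A); case: (w \in A) => /=; lia.
Qed.

Lemma flux_trans A x y w : (flux A (y, x) + flux A (x, w) = flux A (y, w))%R.
Proof. by rewrite /flux /=; lia. Qed.

Lemma lift_net S e i j x y w D : i \in S -> j \in S -> i != j ->
  same_ends (e i) (x, y) -> same_ends (e j) (x, w) ->
  orients (S :\ j) (upd e i (y, w)) D ->
  exists D', orients S e D' /\ forall A, net S D' A = net (S :\ j) D A.
Proof.
move=> iS jS ij ei ej oD.
have iS' : i \in S :\ j by rewrite !inE ij.
have oi : same_ends (y, w) (D i) by have := oD i iS'; rewrite /upd eqxx.
pose D' l := if l == i then (if D i == (y, w) then (y, x) else (x, y))
  else if l == j then (if D i == (y, w) then (x, w) else (w, x)) else D l.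
exists D'; split.
  move=> l lS; rewrite /D'; case: eqP => [->|/eqP li].
    by case: ifP => _; move: ei; rewrite /same_ends /= orbC => /orP[] /eqP ->; rewrite ?eqxx ?orbT.
  case: eqP => [->|/eqP lj].
    by case: ifP => _; move: ej; rewrite /same_ends /= orbC => /orP[] /eqP ->; rewrite ?eqxx ?orbT.
  by have := oD l; rewrite !inE lj /upd (negbTE li); apply.
move=> A; rewrite /net (sum_split2 _ iS jS ij) (big_setD1 i iS') /=.
have -> : (\sum_(l in S :\ j :\ i) flux A (D' l) =
    \sum_(l in S :\ j :\ i) flux A (D l))%R.
  by apply: eq_bigr => l; rewrite !inE /D' => /and3P[/negbTE-> /negbTE->].
have ji : (j == i) = false by rewrite eq_sym; apply: negbTE.
rewrite addrA /D' !eqxx ji; congr (_ + _)%R.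
move: oi; case: ifP => [/eqP -> _|nE /orP[] /eqP /= E]; first exact: flux_trans.
  by rewrite E eqxx in nE.
have -> : D i = (w, y) by rewrite [D i]surjective_pairing; case: E => -> ->.
by rewrite addrC flux_trans.
Qed.

Definition add1 (f : T -> nat) x : T -> nat := fun v => f v + (v == x).
Definition sub1 (f : T -> nat) x : T -> nat := fun v => f v - (v == x).
Definition updz z d f : bool -> T -> nat := fun d' => if d' == d then f else z d'.

Lemma zsum_add1 f x A : zsum (add1 f x) A = zsum f A + (x \in A).
Proof.
rewrite /zsum /add1 big_split /=; congr (_ + _).
by have := sum_pred1 A x true; rewrite andbT => <-; apply: eq_bigr => v _; rewrite andbT eq_sym.
Qed.

Lemma zsum_sub1 f x A : 0 < f x -> zsum f A = zsum (sub1 f x) A + (x \in A).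
Proof.
move=> fx; rewrite -zsum_add1; apply: eq_bigr => v _; rewrite /add1 /sub1.
by case: eqP => [->|_]; rewrite ?subn0 ?addn0 // subnK.
Qed.

(* The edges at x, sorted by their other end: a vertex, or z0 in direction d. *)
Definition half_edges S e z x (p : T + bool) : nat :=
  match p with
  | inl y => if y == x then 0 else cut (inner S e [set x; y]) e [set x]
  | inr d => z d x
  end.
Definition end_in A (p : T + bool) := if p is inl y then y \in A else false.

Lemma link_inner S e x y i : i \in S -> y != x ->
  (i \in inner S e [set x; y]) && crosses [set x] (e i) = same_ends (e i) (x, y).
Proof.
move=> iS yx; rewrite !inE iS /crosses !inE /same_ends /=.
case: (e i) => a b; rewrite !xpair_eqE /=.
have [->|ax] := eqVneq a x; have [->|bx] := eqVneq b x;
  rewrite /= ?eqxx /= ?andbF ?orbF ?andbT //=.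
by rewrite eq_sym (negbTE yx).
Qed.

Lemma cut_link S e x y : y != x ->
  cut (inner S e [set x; y]) e [set x] = \sum_(i in S) same_ends (e i) (x, y).
Proof.
move=> yx; rewrite /cut (sum_subset (S := S)).
  by apply: eq_bigr => i iS; rewrite -(link_inner e iS yx); case: ifP.
by apply/subsetP => i; rewrite inE => /andP[].
Qed.

Lemma half_edges_sum S e z x :
  \sum_p half_edges S e z x p = wdeg S e z [set x].
Proof.
rewrite big_sumType /= big_bool /= /wdeg !zsum1 -addnA; congr (_ + _).
transitivity (\sum_y \sum_(i in S) ((y != x) && same_ends (e i) (x, y) : nat)).
  apply: eq_bigr => y _; case: eqP => [_|/eqP yx] /=; first by rewrite big1.
  exact: cut_link.
rewrite exchange_big; apply: eq_bigr => i iS; rewrite /crosses !inE /same_ends.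
case: (e i) => a b /=.
under eq_bigr do rewrite !xpair_eqE.
have [->|ax] := eqVneq a x; have [->|bx] := eqVneq b x => /=.
- by rewrite big1 // => y _; case: eqVneq.
- rewrite (bigD1 b) //= bx eqxx /= big1 // => y yb.
  by rewrite [b == y]eq_sym (negbTE yb) !andbF.
- rewrite (bigD1 a) //= (negbTE ax) !eqxx /= big1 // => y ya.
  by rewrite [a == y]eq_sym (negbTE ya) !andbF.
- by rewrite big1 // => y _; rewrite !andbF.
Qed.

Lemma half_edge_inl S e z x y : 0 < half_edges S e z x (inl y) ->
  exists2 i, i \in S & same_ends (e i) (x, y).
Proof.
rewrite /=; case: eqP => // /eqP yx; rewrite cut_link // lt0n sum_nat_eq0.
by rewrite negb_forall_in => /exists_inP[i iS]; rewrite eqb0 negbK; exists i.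
Qed.

Lemma half_edge_inl2 S e z x y : 1 < half_edges S e z x (inl y) ->
  exists i j, [/\ i \in S, j \in S, i != j, same_ends (e i) (x, y) & same_ends (e j) (x, y)].
Proof.
rewrite /=; case: eqP => // /eqP yx; rewrite cut_link //.
have -> : \sum_(i in S) same_ends (e i) (x, y) = #|[set i in S | same_ends (e i) (x, y)]|.
  by rewrite cardsE -sum1_card big_mkcondr.
case/card_gt1P => i [j [iS jS ij]]; exists i, j.
by move: iS jS; rewrite !inE => /andP[? ?] /andP[? ?].
Qed.

End Lifting.

Section SplittingOff.

Variables (T I : finType) (k : nat).
Implicit Types (S : {set I}) (e D : I -> T * T) (A B U X : {set T}).
Implicit Types (z : bool -> T -> nat) (c : T -> int).

(* Splitting off a most frequent end against another one leaves every other end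
   with at most half of the edges; a majority end is split off against itself. *)
Lemma choose_pair (C : finType) (n : C -> nat) h : 0 < h ->
  \sum_p n p = 2 * h ->
  exists p q, [/\ if p == q then h < n p else (0 < n p) && (0 < n q) &
                  forall f, f != p -> f != q -> n f < h].
Proof.
move=> h0 En.
have [p0 _] : exists p : C, true.
  apply/existsP; apply: contraTT h0 => /existsPn none.
  by rewrite big1 in En => [|p _]; [lia | have := none p].
pose p := [arg max_(p > p0) n p].
have pmax q : n q <= n p by rewrite /p; case: arg_maxnP => //= i _; apply.
have sum2 f g : f != g -> n f + n g <= 2 * h.
  move=> fg; rewrite -En (bigD1 f) //= (bigD1 g) ?(eq_sym g) //=; lia.
have [lt|le] := ltnP h (n p).
  exists p, p; rewrite eqxx; split => // f fp _; have := sum2 f p fp; lia.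
have [q qp q0] : exists2 q, q != p & 0 < n q.
  apply/exists_inP; apply: contraTT h0 => /exists_inPn none.
  have := En; rewrite (bigD1 p) //= big1 => [|q /none]; lia.
exists p, q; rewrite eq_sym (negbTE qp) q0.
have p0' : 0 < n p by have := pmax q; lia.
rewrite p0'; split => // f fp fq; rewrite ltnNge; apply/negP => hf.
have : n f + n p + n q <= 2 * h.
  rewrite -En (bigD1 f) //= (bigD1 p) ?(eq_sym p) //= (bigD1 q) /= ?qp ?(eq_sym q) ?fq //.
  lia.
have := pmax f; lia.
Qed.

Definition lift_of U S e z c x (p q : T + bool) S' e' z' :=
  [/\ within U S' e',
      [/\ zsum (z' true) U <= zsum (z true) U, zsum (z' false) U <= zsum (z false) U &
      ((zsum (z' true) U)%:Z - (zsum (z' false) U)%:Z =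
        (zsum (z true) U)%:Z - (zsum (z false) U)%:Z)%R],
      forall d, z' d x = z d x - (p == inr d) - (q == inr d),
      forall A, wdeg S e z A = wdeg S' e' z' A +
        2 * (if x \in A then ~~ end_in A p && ~~ end_in A q
             else end_in A p && end_in A q) &
      forall D, solves k U S' e' z' c D -> exists D', solves k U S e z c D'].

Lemma lift_edges U S e z c x y w i j : within U S e -> x \in U ->
  i \in S -> j \in S -> i != j -> same_ends (e i) (x, y) -> same_ends (e j) (x, w) ->
  lift_of U S e z c x (inl y) (inl w) (S :\ j) (upd e i (y, w)) z.
Proof.
move=> HU xU iS jS ij ei ej; split => //.
- have memU l a b : l \in S -> same_ends (e l) (a, b) -> b \in U.
    by move=> /HU /andP[h1 h2] /orP[] /eqP E; rewrite E in h1 h2.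
  move=> l; rewrite /upd !inE => /andP[lj lS]; case: eqP => _; last exact: HU.
  by rewrite (memU _ _ _ iS ei) (memU _ _ _ jS ej).
- by move=> d; rewrite !subn0.
- move=> A; rewrite /wdeg (lift_cut A iS jS ij ei ej) /=.
  by case: (x \in A); case: (y \in A); case: (w \in A) => /=; lia.
- move=> D [oD sD]; have [D' [oD' E]] := lift_net iS jS ij ei ej oD.
  by exists D'; split => // v vU; rewrite E; apply: sD.
Qed.

Lemma lift_edge_z U S e z c x y i d : within U S e -> x \in U ->
  i \in S -> y != x -> same_ends (e i) (x, y) -> 0 < z d x ->
  lift_of U S e z c x (inl y) (inr d) (S :\ i) e
    (updz z d (add1 (sub1 (z d) x) y)).
Proof.
move=> HU xU iS yx ei zx.
have yU : y \in U by case/andP: (HU i iS); case/orP: ei => /eqP -> /=.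
have zA A : zsum (add1 (sub1 (z d) x) y) A + (x \in A) = zsum (z d) A + (y \in A).
  by rewrite zsum_add1 (zsum_sub1 A zx); lia.
split.
- by move=> l; rewrite !inE => /andP[_]; apply: HU.
- have := zA U; rewrite xU yU /updz => /addIn E.
  by case: d zx zA E => zx zA /= ->; split.
- move=> d'; rewrite /updz; case: eqP => [->|nd].
    by rewrite /add1 /sub1 !eqxx eq_sym (negbTE yx) addn0 subn0.
  by rewrite (_ : (inr d == inr d' :> T + bool) = false) ?subn0 //; apply/eqP => -[] /esym.
- move=> A; rewrite /wdeg.
  have -> : cut S e A = cut (S :\ i) e A + ((x \in A) (+) (y \in A)).
    by rewrite /cut (big_setD1 i iS) /= (same_ends_cross A ei) addnC.
  have := zA A; rewrite /updz; case: d {zx zA} => /=;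
    move: (zsum _ _) (zsum _ _) (zsum _ _) (cut _ _ _) => a b a' a2;
    by case: (x \in A); case: (y \in A) => /=; lia.
- move=> D [oD sD].
  pose D' l := if l == i then (if d then (y, x) else (x, y)) else D l.
  exists D'; split.
    move=> l lS; rewrite /D'; case: eqP => [->|/eqP li]; last by apply: oD; rewrite !inE li.
    by move: ei; rewrite /same_ends /= orbC; case: (d) => /orP[] /eqP ->; rewrite ?eqxx ?orbT.
  move=> v vU; have [j Hj] := sD v vU; exists j; rewrite -Hj.
  rewrite {1}/net (big_setD1 i iS) /= {1}/D' eqxx.
  have -> : (\sum_(l in S :\ i) flux [set v] (D' l) = net (S :\ i) D [set v])%R.
    by apply: eq_bigr => l; rewrite !inE /D' => /andP[/negbTE->].
  move: (zA [set v]) (net _ _ _); rewrite !zsum1 !inE /updz /flux; clear.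
  case: d => /=; rewrite !inE; case: (x == v); case: (y == v) => /= E m; lia.
Qed.

Lemma lift_of_sym U S e z c x p q S' e' z' :
  lift_of U S e z c x p q S' e' z' -> lift_of U S e z c x q p S' e' z'.
Proof.
move=> [h1 h2 h3 h4 h5]; split => // [d|A]; first by rewrite h3 subnAC.
by rewrite h4 andbC [end_in A p && _]andbC.
Qed.

Lemma lift_zz U S e z c x d : within U S e -> x \in U -> (forall d, 0 < z d x) ->
  lift_of U S e z c x (inr d) (inr (~~ d)) S e (fun d => sub1 (z d) x).
Proof.
move=> HU xU zx; have zA d' A := zsum_sub1 A (zx d').
split => //.
- have := zA true U; have := zA false U; rewrite xU => -> ->.
  by split; rewrite ?leq_addr // !PoszD; lia.
- by move=> d'; rewrite /sub1 eqxx; case: d; case: d'; rewrite /= ?subn0.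
- by move=> A; rewrite /wdeg !zA; case: (x \in A) => /=; lia.
- move=> D [oD sD]; exists D; split => // v /sD [j Hj]; exists j; rewrite -Hj.
  have := zA true [set v]; have := zA false [set v]; rewrite !zsum1 => -> ->; lia.
Qed.

End SplittingOff.

Section SpecialVertex.

Variables (T I : finType) (k : nat).
Hypothesis k_gt0 : 0 < k.
Implicit Types (S : {set I}) (e D : I -> T * T) (A B U X : {set T}).
Implicit Types (z : bool -> T -> nat) (c : T -> int).

Lemma small_le a g a' g' : a' <= a -> g' <= g -> small k a g -> small k a' g'.
Proof. by rewrite /small => ? ? /orP[] /andP[? ?]; apply/orP; [left|right]; lia. Qed.

Lemma good_pred w x : good k k k w x -> good k k.-1 k.-1 (w - 2) x.
Proof. by move=> [o [i [j [? ? ? ?]]]]; exists o.-1, i.-1, j; split; lia. Qed.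

Lemma inner_orients U S e D :
  (forall i, i \in S -> i \in inner S e U \/ (e i).1 = (e i).2) ->
  orients (inner S e U) e D ->
  exists D', orients S e D' /\ forall A, net S D' A = net (inner S e U) D A.
Proof.
move=> loop oD; pose D' i := if i \in inner S e U then D i else e i.
have sS : inner S e U \subset S by apply/subsetP => i; rewrite inE => /andP[].
exists D'; split => [i iS|A].
  by rewrite /D'; case: ifP => [/oD //|_]; rewrite /same_ends eqxx.
rewrite /net (sum_subset _ sS); apply: eq_bigr => i iS; rewrite /D'.
by case: ifP => // ni; case: (loop i iS) => [|E]; [rewrite ni | rewrite /flux E subrr].
Qed.

Lemma cut_inner U S e A :
  (forall i, i \in S -> i \in inner S e U \/ (e i).1 = (e i).2) ->
  cut (inner S e U) e A = cut S e A.
Proof.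
move=> loop; rewrite /cut (sum_subset (S := S)); last by apply/subsetP => i; rewrite inE => /andP[].
apply: eq_bigr => i iS; case: ifP => // ni; case: (loop i iS) => [|E]; first by rewrite ni.
by rewrite /crosses E addbb.
Qed.

Lemma same_ends_inj (p : T * T) x y w :
  y != x -> same_ends p (x, y) -> same_ends p (x, w) -> y = w.
Proof.
move=> yx; rewrite /same_ends /= => /orP[] /eqP -> /orP[] /eqP[] //.
- by move=> _ E; rewrite E eqxx in yx.
- by move=> E; rewrite E eqxx in yx.
Qed.

Lemma isolated_loop U S e x : within U S e -> cut S e [set x] = 0 ->
  forall i, i \in S -> i \in inner S e (U :\ x) \/ (e i).1 = (e i).2.
Proof.
move=> HU /eqP; rewrite sum_nat_eq0 => /forall_inP c0 i iS.
have := c0 i iS; rewrite eqb0 /crosses !inE iS; have /andP[-> ->] := HU i iS.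
rewrite !andbT /=; case: eqP => [->|_]; case: eqP => [->|_] //=; first by right.
by left.
Qed.

Lemma solve_special n U x :
  #|U :\ x| = n ->
  (forall X' U' S' e' z' c', #|U' :\: X'| < n ->
     feasible k X' U' S' e' z' c' -> exists D : I -> T * T, solves k U' S' e' z' c' D) ->
  (forall U' S' e' z' c', #|U'| = n ->
     feasible k set0 U' S' e' z' c' -> exists D : I -> T * T, solves k U' S' e' z' c' D) ->
  forall h S e z c, feasible k [set x] U S e z c -> wdeg S e z [set x] = 2 * h ->
  exists D, solves k U S e z c D.
Proof.
move=> Un IH H0; elim=> [|h IHh] S e z c F wx.
  have [xU _ [j cx] _] := fe_special F (set11 x).
  have cut0 : cut S e [set x] = 0 by move: wx; rewrite /wdeg; lia.
  have zx d : z d x = 0 by move: wx; rewrite /wdeg !zsum1; case: d; lia.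
  have loop := isolated_loop (fe_within F) cut0.
  have zU d : zsum (z d) U = zsum (z d) (U :\ x) by rewrite /zsum (big_setD1 x) //= zx.
  have [D [oD sD]] : exists D : I -> T * T, solves k (U :\ x) (inner S e (U :\ x)) e z c D.
    apply: H0 => //; split.
    - by move=> i; rewrite inE => /andP[].
    - by rewrite -!zU; exact: fe_small F.
    - rewrite -!zU; have [j' Hj'] := fe_total F; exists (j' + j)%R; move: Hj'.
      rewrite {1}/csum (big_setD1 x) //= -/(csum _ _); lia.
    - move=> A u v sA vA _; rewrite !inE => /andP[ux uU] uA _.
      rewrite /wdeg cut_inner //; apply: (@fe_good _ _ _ _ _ _ _ _ _ F A u v) => //; rewrite ?inE //.
        exact: subset_trans sA (subsetDl _ _).
      by apply: contraTneq vA => ->; apply/negP => /(subsetP sA); rewrite !inE eqxx.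
    - by move=> y; rewrite inE.
  have [D' [oD' nD']] := inner_orients loop oD.
  exists D'; split => // v vU; rewrite nD'.
  have [->|vx] := eqVneq v x; last by apply: sD; rewrite !inE vx.
  exists (- j)%R; rewrite -nD' cx !zx [net _ _ _]big1; first by lia.
  move=> i iS; have /esym := same_ends_cross [set x] (oD' i iS).
  have : crosses [set x] (e i) = false.
    by move/eqP: cut0; rewrite sum_nat_eq0 => /forall_inP/(_ i iS); rewrite eqb0 => /negbTE.
  by move=> ->; rewrite /crosses /flux; case: (_ \in _); case: (_ \in _).
have [/existsP[B /existsP[u /and5P[sB B1 uU uB /andP[ux /goodP ng]]]]|fat] :=
  boolP [exists B : {set T}, exists u, [&& B \subset U, 1 < #|B :\: [set x]|, u \in U,
    u \notin B & (u \notin [set x]) && ~~ goodb k k k (wdeg S e z B) (csum c B)]].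
  by apply: (reduce F sB B1 uU uB ux ng) => X' U' S' e' z' c'; rewrite Un; exact: IH.
have {}fat B u : B \subset U -> 1 < #|B :\ x| -> u \in U -> u \notin B -> u != x ->
    good k k k (wdeg S e z B) (csum c B).
  move=> sB B1 uU uB ux; apply/goodP; apply: contraNT fat => ng.
  apply/existsP; exists B; apply/existsP; exists u.
  by rewrite sB B1 uU uB inE ux ng.
have [xU _ [j cx] [h' [wx' zx]]] := fe_special F (set11 x).
have {wx' h'} zx d : z d x <= h.+1 by have := zx d; lia.
have [p [q [Hpq Hf]]] := choose_pair (ltn0Sn h) (etrans (half_edges_sum S e z x) wx).
have [S' [e' [z' L]]] : exists S' e' z', lift_of k U S e z c x p q S' e' z'.
  have [E|pq] := eqVneq p q.
    rewrite -E eqxx in Hpq *; case: p Hpq {Hf E q} => [y|d] hp; last first.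
      by have := zx d; rewrite /= in hp; lia.
    have [i [j' [iS jS ij ei ej]]] := half_edge_inl2 (leq_trans (ltn0Sn h : 1 < h.+2) hp).
    by eexists _, _, _; apply: (lift_edges k z c (fe_within F) xU iS jS ij ei ej).
  rewrite (negbTE pq) in Hpq.
  case: p q pq Hpq {Hf} => [y|d] [w|d'] pq /andP[hp hq].
  - have [i iS ei] := half_edge_inl hp; have [j' jS ej] := half_edge_inl hq.
    have yx : y != x by apply: contraTneq hp => ->; rewrite /= eqxx.
    have ij : i != j'.
      apply: contra pq => /eqP E; rewrite -E in ej.
      by rewrite (same_ends_inj yx ei ej).
    by eexists _, _, _; apply: (lift_edges k z c (fe_within F) xU iS jS ij ei ej).
  - have [i iS ei] := half_edge_inl hp.
    have yx : y != x by apply: contraTneq hp => ->; rewrite /= eqxx.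
    by eexists _, _, _; apply: (lift_edge_z k c (fe_within F) xU iS yx ei hq).
  - have [i iS ei] := half_edge_inl hq.
    have yx : w != x by apply: contraTneq hq => ->; rewrite /= eqxx.
    by eexists _, _, _; apply/lift_of_sym/(lift_edge_z k c (fe_within F) xU iS yx ei hp).
  - exists S, e, (fun d => sub1 (z d) x).
    have dd : d' = ~~ d by case: d d' {hp hq} pq => [] [].
    rewrite dd in hq *; apply: lift_zz (fe_within F) xU _ => d0.
    by case: d d0 hp hq {pq dd} => [] [].
have pne y : (y == x) && ((p == inl y) || (q == inl y)) = false.
  have n0 : half_edges S e z x (inl x) = 0 by rewrite /= eqxx.
  apply/negP => /andP[/eqP -> /orP[] /eqP E]; move: Hpq; case: eqP => [Epq|_];
    by rewrite ?E ?Epq ?E n0 ?andbF.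
have [W' [Z1 Z2 Z3] zx' wA sol] := L.
have wx' : wdeg S' e' z' [set x] = 2 * h.
  have := wA [set x]; rewrite wx set11.
  have -> : end_in [set x] p = false.
    by case: (p) pne => //= y /(_ y); rewrite eqxx /= andbT inE.
  have -> : end_in [set x] q = false.
    by case: (q) pne => //= y /(_ y); rewrite eqxx orbT andbT inE.
  by rewrite /=; lia.
have cD1 A : x \in A -> csum c A = (c x + csum c (A :\ x))%R.
  by move=> xA; rewrite /csum (big_setD1 x).
suff F' : feasible k [set x] U S' e' z' c by have [D sD] := IHh S' e' z' c F' wx'; apply: sol sD.
split => //.
- exact: small_le (fe_small F).
- by rewrite Z3; exact: fe_total F.
- move=> A u v sA vA; rewrite !inE => vx uU uA ux.
  have := wA A; case dA: (if x \in A then _ else _); last first.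
    rewrite muln0 addn0 => <-.
    by apply: (@fe_good _ _ _ _ _ _ _ _ _ F A u v) => //; rewrite !inE.
  move=> wA2; have {wA2} -> : wdeg S' e' z' A = wdeg S e z A - 2 by rewrite wA2 addnK.
  have [A1|A1] := ltnP 1 #|A :\ x|; first by apply: good_pred; apply: fat uU uA ux.
  have AE : A :\ x = [set v].
    by apply/esym/eqP; rewrite eqEcard sub1set !inE vx vA cards1.
  have vU := subsetP sA _ vA.
  have uv : u != v by apply: contraNneq uA => ->.
  have [xA|xA] := boolP (x \in A); last first.
    rewrite (negbTE xA) in dA; have AE' : A = [set v].
      by rewrite -AE; apply/setP => y; rewrite !inE; case: eqP => // ->; rewrite (negbTE xA).
    have [E1 E2] : p = inl v /\ q = inl v.
      move: dA; rewrite AE'; case: (p) => //= y; rewrite inE => /andP[/eqP ->].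
      by case: (q) => //= w; rewrite inE => /eqP ->.
    move: Hpq; rewrite E1 E2 eqxx /= (negbTE vx) => Hn.
    have := wdegD1 S e z (set21 x v); set m := cut _ _ _ in Hn *.
    have -> : [set x; v] :\ x = [set v].
      by apply/setP => y; rewrite !inE; case: eqP => // ->; rewrite eq_sym (negbTE vx).
    rewrite wx AE' => EB.
    have -> : wdeg S e z [set v] - 2 = wdeg S e z [set x; v] + 2 * (m - h.+2) by clear -EB Hn; lia.
    apply: good_add2; apply: (@good_cong _ _ _ _ (csum c [set x; v])).
      exists j; rewrite cD1 ?set21 //.
      have -> : [set x; v] :\ x = [set v].
        by apply/setP => y; rewrite !inE; case: eqP => // ->; rewrite eq_sym (negbTE vx).
      by clear -cx; lia.
    apply: (@fe_good _ _ _ _ _ _ _ _ _ F _ u v); rewrite ?inE ?eqxx ?orbT ?negb_or ?ux //.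
    by apply/subsetP => y /set2P[] ->.
  have Hn : half_edges S e z x (inl v) < h.+1.
    move: dA; rewrite xA => /andP[dp dq]; apply: Hf.
      by apply: contraNneq dp => <- /=.
    by apply: contraNneq dq => <- /=.
  rewrite /= (negbTE vx) in Hn.
  have := wdegD1 S e z xA; rewrite AE wx.
  have AE2 : A = [set x; v] by rewrite -(setD1K xA) AE.
  rewrite {2}AE2; set m := cut _ _ _ in Hn * => EB.
  have -> : wdeg S e z A - 2 = wdeg S e z [set v] + 2 * (h - m) by clear -EB Hn; lia.
  apply: good_add2; apply: (@good_cong _ _ _ _ (csum c [set v])).
    by exists (- j)%R; rewrite (cD1 A) // AE; clear -cx; lia.
  by apply: (@fe_good _ _ _ _ _ _ _ _ _ F _ u v); rewrite ?inE ?eqxx ?sub1set.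
- move=> y /set1P ->; split => //; first by exists j.
  exists h; split => // d; rewrite zx'; have := zx d; have := Hf (inr d).
  by rewrite /= !(eq_sym (inr d)); case: (p == _); case: (q == _) => //=; lia.
Qed.

End SpecialVertex.

(** * The extension theorem *)

Section Extension.

Variables (T I : finType) (k : nat).
Hypothesis k_gt2 : 2 < k.
Implicit Types (S : {set I}) (e D : I -> T * T) (A B U X : {set T}).
Implicit Types (z : bool -> T -> nat) (c : T -> int) (d : bool).

Let k_gt0 : 0 < k := ltnW (ltnW k_gt2).

Definition sg d : int := if d then 1%R else (-1)%R.
Definition updc c v (x : int) : T -> int := fun u => if u == v then (c u + x)%R else c u.
Definition ok d S e z c v :=
  goodb k (k.-1 + d) (k.-1 + ~~ d) (wdeg S e z [set v]) (c v).
Definition fat U S e z c := forall B u, B \subset U -> 1 < #|B| -> u \in U -> u \notin B ->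
  good k k k (wdeg S e z B) (csum c B).

Lemma csum_updc c v x A :
  (csum (updc c v x) A = csum c A + (if v \in A then x else 0))%R.
Proof.
rewrite /csum; case: ifP => vA; last first.
  by rewrite addr0; apply: eq_bigr => u uA; rewrite /updc; case: eqP uA => // ->; rewrite vA.
rewrite (big_setD1 v) //= [in RHS](big_setD1 v) //= /updc eqxx addrAC; congr (_ + _ + _)%R.
by apply: eq_bigr => u; rewrite !inE => /andP[/negbTE->].
Qed.

Lemma good_shift d w x : good k (k.-1 + d) (k.-1 + ~~ d) w x ->
  good k k.-1 k.-1 (w - 1) (x - sg d)%R.
Proof.
move=> [o [i [j [h1 h2 h3 h4]]]]; rewrite /sg; case: d h1 h2 => h1 h2.
  by exists o.-1, i, j; split; lia.
by exists o, i.-1, j; split; lia.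
Qed.

Lemma good_move d j w x : good k k k w x ->
  good k k.-1 k.-1 (w + j - 1) (x + sg d * j.+1%:Z)%R.
Proof.
move=> [o [i [q [h1 h2 h3 h4]]]]; rewrite /sg; case: d.
  by exists (o + j), i.-1, q; split; lia.
by exists o.-1, (i + j), q; split; lia.
Qed.

Lemma good_add d j w x : good k k k w x ->
  good k k.-1 k.-1 (w + j) (x + sg d * j%:Z)%R.
Proof.
move=> [o [i [q [h1 h2 h3 h4]]]]; rewrite /sg; case: d.
  by exists (o + j), i, q; split; lia.
by exists o, (i + j), q; split; lia.
Qed.

Lemma good_weak w x d : good k k k w x -> good k (k.-1 + d) (k.-1 + ~~ d) w x.
Proof. by move=> [o [i [q [h1 h2 h3 h4]]]]; exists o, i, q; case: d; split; lia. Qed.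

Lemma card_le1_set1 A v : v \in A -> ~~ (1 < #|A|) -> A = [set v].
Proof. by move=> vA; rewrite -leqNgt => A1; apply/esym/eqP; rewrite eqEcard sub1set vA cards1. Qed.

Lemma delete_z U S e z c d v :
  feasible k set0 U S e z c -> fat U S e z c -> v \in U -> 0 < z d v -> ok d S e z c v ->
  feasible k set0 U S e (updz z d (sub1 (z d) v)) (updc c v (- sg d)%R).
Proof.
move=> F fatU vU zv /goodP okv; have zA A := zsum_sub1 A zv.
have zd A : zsum (z (~~ d)) A = zsum (updz z d (sub1 (z d) v) (~~ d)) A.
  by rewrite /updz; case: (d).
have wA A : wdeg S e z A = wdeg S e (updz z d (sub1 (z d) v)) A + (v \in A).
  by rewrite /wdeg; have := zA A; rewrite /updz; case: (d) => /= ->; clear; lia.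
split.
- exact: fe_within F.
- have := fe_small F; have := zA U; rewrite /updz.
  by case: (d) => /= ->; apply: small_le; rewrite ?leq_addr.
- have [j Hj] := fe_total F; exists j; rewrite csum_updc vU.
  by move: Hj (zA U); rewrite /updz /sg vU; case: (d) => /=; clear; lia.
- move=> A u v0 sA uA _ v0U v0A _; rewrite csum_updc.
  have := wA A; have [vA|vA] := boolP (v \in A); last first.
    rewrite addn0 addr0 => <-; apply: (@fe_good _ _ _ _ _ _ _ _ _ F A u v0); rewrite ?inE //.
  move=> E; have {E} -> : wdeg S e (updz z d (sub1 (z d) v)) A = wdeg S e z A - 1.
    by rewrite E addnK.
  apply: good_shift; have [A1|A1] := boolP (1 < #|A|).
    by apply: good_weak; apply: fatU v0U v0A.
  by rewrite (card_le1_set1 vA A1) csum1.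
- by move=> x; rewrite inE.
Qed.

Lemma delete_z_solves U S e z c d v D : 0 < z d v ->
  solves k U S e (updz z d (sub1 (z d) v)) (updc c v (- sg d)%R) D ->
  solves k U S e z c D.
Proof.
move=> zv [oD sD]; split => // u /sD [j Hj]; exists j; move: Hj.
have := zsum_sub1 [set u] zv; rewrite !zsum1 inE /updz /updc /sg eq_sym.
by move: (net _ _ _); clear; case: (d); case: (u == v) => /= m; lia.
Qed.

Definition addz z d v j : bool -> T -> nat := updz z d (fun u => z d u + (if u == v then j else 0)).

Lemma zsum_addz z d v j d' A :
  zsum (addz z d v j d') A = zsum (z d') A + (if (d' == d) && (v \in A) then j else 0).
Proof.
rewrite /addz /updz; case: eqP => [->|_] /=; last by rewrite addn0.
rewrite /zsum big_split /= -big_mkcondr; congr (_ + _); case: ifP => vA.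
  by rewrite (big_pred1 v) // => u /=; case: eqVneq => [->|]; rewrite ?vA ?andbF.
by rewrite big1 // => u /andP[uA /eqP E]; rewrite E vA in uA.
Qed.

Lemma delete_edge U S e z c d i u v j (z' := addz z d v j)
    (c' := updc (updc c u (- sg d)%R) v (sg d * j.+1%:Z)%R) :
  feasible k set0 U S e z c -> fat U S e z c ->
  i \in S -> u != v -> same_ends (e i) (u, v) ->
  small k (zsum (z' true) U) (zsum (z' false) U) ->
  ok d S e z c u ->
  good k k.-1 k.-1 (wdeg S e z [set v] + j - 1) (c v + sg d * j.+1%:Z)%R ->
  feasible k set0 U (S :\ i) e z' c'.
Proof.
move=> F fatU iS uv ei sm /goodP oku gv.
have [uU vU] : u \in U /\ v \in U.
  by have := fe_within F iS; case/orP: ei => /eqP -> /= /andP[].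
have wA A : wdeg (S :\ i) e z' A + ((u \in A) (+) (v \in A)) =
    wdeg S e z A + (if v \in A then j else 0).
  rewrite /wdeg !zsum_addz.
  have -> : cut S e A = cut (S :\ i) e A + ((u \in A) (+) (v \in A)).
    by rewrite /cut (big_setD1 i iS) /= (same_ends_cross A ei) addnC.
  by clear; case: (d); case: (v \in A) => /=; lia.
have cA A : (csum c' A = csum c A + (if u \in A then - sg d else 0) +
    (if v \in A then sg d * j.+1%:Z else 0))%R by rewrite !csum_updc.
split.
- by move=> l; rewrite !inE => /andP[_]; apply: (fe_within F).
- exact: sm.
- have [q Hq] := fe_total F; exists q; rewrite cA uU vU !zsum_addz vU /sg.
  by move: Hq; clear; case: (d) => /=; lia.
- move=> A v0 u0 sA u0A _ v0U v0A _; have := wA A; rewrite cA.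
  have fatA : 1 < #|A| -> good k k k (wdeg S e z A) (csum c A) by move=> A1; apply: fatU v0U v0A.
  have [uA|uA] := boolP (u \in A); have [vA|vA] := boolP (v \in A) => /=.
  + rewrite addn0 => ->; have -> : (csum c A - sg d + sg d * j.+1%:Z =
        csum c A + sg d * j%:Z)%R by rewrite /sg; clear; case: (d); lia.
    apply: good_add; apply: fatA; apply/card_gt1P; exists u, v; split=> //.
  + rewrite addn0 addr0 => E; have {E} -> : wdeg (S :\ i) e z' A = wdeg S e z A - 1.
      by rewrite -E addnK.
    apply: good_shift; have [A1|A1] := boolP (1 < #|A|); first exact/good_weak/fatA.
    by rewrite (card_le1_set1 uA A1) csum1.
  + rewrite addr0 => E; have {E} -> : wdeg (S :\ i) e z' A = wdeg S e z A + j - 1.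
      by rewrite -E addnK.
    have [A1|A1] := boolP (1 < #|A|); first exact/good_move/fatA.
    by rewrite (card_le1_set1 vA A1) csum1.
  + rewrite !addn0 !addr0 => ->.
    by apply: (@fe_good _ _ _ _ _ _ _ _ _ F A v0 u0); rewrite ?inE.
- by move=> x; rewrite inE.
Qed.

Lemma delete_edge_solves U S e z c d i u v j D :
  i \in S -> u != v -> same_ends (e i) (u, v) ->
  solves k U (S :\ i) e (addz z d v j)
    (updc (updc c u (- sg d)%R) v (sg d * j.+1%:Z)%R) D ->
  exists D', solves k U S e z c D'.
Proof.
move=> iS uv ei [oD sD].
pose D' l := if l == i then (if d then (u, v) else (v, u)) else D l.
exists D'; split.
  move=> l lS; rewrite /D'; case: eqP => [->|/eqP li]; last by apply: oD; rewrite !inE li.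
  by move: ei; rewrite /same_ends /= orbC; case: (d) => /orP[] /eqP ->; rewrite ?eqxx ?orbT.
move=> w /sD [q Hq]; exists q; move: Hq.
rewrite {2}/net (big_setD1 i iS) /= {1}/D' eqxx.
have -> : (\sum_(l in S :\ i) flux [set w] (D' l) = net (S :\ i) D [set w])%R.
  by apply: eq_bigr => l; rewrite !inE /D' => /andP[/negbTE->].
rewrite /addz /updz /updc /sg /flux.
have Ew : (w == v) = (v == w) by rewrite eq_sym.
have Eu : (w == u) = (u == w) by rewrite eq_sym.
have : (u == w) && (v == w) = false.
  by apply: contraNF uv => /andP[/eqP -> /eqP ->].
move: (net _ _ _) => m; case: (d); rewrite /= !inE ?Ew ?Eu; clear;
  case: (u == w); case: (v == w) => //= _; lia.
Qed.

(* The cut of U :\ x bounds the number of edges between x and z0. *)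
Lemma zero_vertex_special U S e z c x u :
  feasible k set0 U S e z c -> x \in U -> u \in U -> u != x ->
  ~~ ok true S e z c x -> ~~ ok false S e z c x -> feasible k [set x] U S e z c.
Proof.
move=> F xU uU ux /goodP no1 /goodP no2.
have gx : good k k.-1 k.-1 (wdeg S e z [set x]) (c x).
  rewrite -csum1; apply: (@fe_good _ _ _ _ _ _ _ _ _ F _ u x); rewrite ?inE ?sub1set ?eqxx //.
have [o [i [j [h1 h2 h3 h4]]]] := gx.
have o1 : o = k.-1.
  apply/eqP; rewrite eqn_leq h1 andbT leqNgt; apply/negP => h5; apply: no1.
  by exists o, i, j; split; rewrite ?addn1 ?addn0.
have i1 : i = k.-1.
  apply/eqP; rewrite eqn_leq h2 andbT leqNgt; apply/negP => h5; apply: no2.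
  by exists o, i, j; split; rewrite ?addn1 ?addn0.
have gU : good k k.-1 k.-1 (wdeg S e z (U :\ x)) (csum c (U :\ x)).
  apply: (@fe_good _ _ _ _ _ _ _ _ _ F _ x u); rewrite ?inE ?ux ?eqxx //.
  exact: subsetDl.
have inU : inner S e U = S.
  by apply/setP => l; rewrite inE; case: (boolP (l \in S)) => // /(fe_within F) ->.
have := wdegD1 S e z xU; rewrite inU.
have -> : wdeg S e z U = zsum (z true) U + zsum (z false) U.
  rewrite /wdeg [cut _ _ _]big1 // => l /(fe_within F) /andP[p1 p2].
  by rewrite /crosses p1 p2.
rewrite {2}/wdeg !zsum1 => EU.
have cU : csum c U = (c x + csum c (U :\ x))%R by rewrite /csum (big_setD1 x).
have [q Hq] := fe_total F; rewrite cU in Hq.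
have zx : z true x + z false x <= k.-1.
  have := fe_small F; case: gU => o' [i' [q' [g1 g2 g3 g4]]].
  move: h3; rewrite /wdeg !zsum1 => h3.
  move: EU h3 h4 Hq; rewrite o1 i1 -g3.
  move: (zsum _ _) (zsum _ _) g4 (cut _ _ _) (z _ _) (z _ _) => b a g4 m zt zf E1 E2 E3 E4.
  clear -k_gt2 g1 g2 g4 E1 E2 E3 E4; rewrite /small => sm.
  rewrite leqNgt; apply/negP => h5.
  have E5 : (o'%:Z - i'%:Z = a%:Z - b%:Z + (q' - q + j) * (2 * k)%:Z)%R by lia.
  have E6 : o' + i' <= a + b - 2 by lia.
  have [/eqP j0|j1|j2] := ltgtP (q' - q + j)%R 0%R.
  - nia.
  - nia.
  - rewrite j2 in E5. lia.
split.
- exact: fe_within F.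
- exact: fe_small F.
- exact: fe_total F.
- by move=> A u' v sA vA vx u'U u'A u'x; apply: (@fe_good _ _ _ _ _ _ _ _ _ F A u' v); rewrite ?inE //.
- move=> y /set1P ->; split => //; first by exists (- j)%R; lia.
  by exists k.-1; split; [lia | case; lia].
Qed.

End Extension.

Section ExtensionTheorem.

Variables (T I : finType) (k : nat).
Hypothesis k_gt2 : 2 < k.
Implicit Types (S : {set I}) (e D : I -> T * T) (A B U X : {set T}).
Implicit Types (z : bool -> T -> nat) (c : T -> int) (d : bool).

Lemma small_total a g : small k a g -> a + g < 4 * k - 4.
Proof. by case/orP => /andP[? ?]; lia. Qed.

Lemma good_ge w x : good k k.-1 k.-1 w x -> 2 * k - 2 <= w.
Proof. by move=> [o [i [j [? ? ? ?]]]]; lia. Qed.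

(* Both sides of the cut carry at least 2k - 2 edges, while fewer than 4k - 4
   edges go to the outside vertex. *)
Lemma crossing_edge U S e z c A u v : feasible k set0 U S e z c ->
  A \subset U -> v \in A -> u \in U -> u \notin A ->
  exists i a b, [/\ i \in S, a \in A, b \in U :\: A & same_ends (e i) (a, b)].
Proof.
move=> F sA vA uU uA.
have g1 : good k k.-1 k.-1 (wdeg S e z A) (csum c A).
  by apply: (@fe_good _ _ _ _ _ _ _ _ _ F A u v); rewrite ?inE.
have g2 : good k k.-1 k.-1 (wdeg S e z (U :\: A)) (csum c (U :\: A)).
  apply: (@fe_good _ _ _ _ _ _ _ _ _ F _ v u); rewrite ?inE ?uU ?uA ?vA //.
    exact: subsetDl.
  exact: (subsetP sA).
have eqc : cut S e (U :\: A) = cut S e A.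
  apply: eq_bigr => i /(fe_within F) /andP[p1 p2]; rewrite /crosses !inE p1 p2.
  by case: (_ \in A); case: (_ \in A).
have zU d : zsum (z d) U = zsum (z d) A + zsum (z d) (U :\: A).
  by rewrite /zsum (big_setID A) /= (setIidPr sA).
have : 0 < cut S e A.
  have := small_total (fe_small F); have := good_ge g1; have := good_ge g2.
  rewrite /wdeg eqc !zU; move: (cut S e A) => m; clear; lia.
rewrite lt0n sum_nat_eq0 negb_forall_in => /exists_inP[i iS].
rewrite eqb0 negbK /crosses; have /andP[p1 p2] := fe_within F iS => cr.
have [a1|a1] := boolP ((e i).1 \in A).
  exists i, (e i).1, (e i).2; rewrite inE p2 /same_ends -surjective_pairing eqxx; split => //.
  by move: cr; rewrite a1 andbT.
exists i, (e i).2, (e i).1; rewrite inE p1 a1 same_ends_swap; split => //.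
by move: cr; rewrite (negbTE a1).
Qed.

Lemma good_ok_other d w x : good k (k.-1 + ~~ d) (k.-1 + d) w x ->
  good k k.-1 k.-1 (w + 0 - 1) (x + sg d * 1%:Z)%R.
Proof.
move=> [o [i [j [h1 h2 h3 h4]]]]; rewrite /sg; case: d h1 h2 => h1 h2.
  by exists o, i.-1, j; split; lia.
by exists o.-1, i, j; split; lia.
Qed.

Lemma good_after_add d w x : good k (k.-1 + d) (k.-1 + ~~ d) w x ->
  exists2 j, j < k & good k k.-1 k.-1 (w + j - 1) (x + sg d * j.+1%:Z)%R.
Proof.
move=> [o [i [q [h1 h2 h3 h4]]]]; rewrite /sg; case: d h1 h2 => h1 h2.
  exists (2 * k - 1 - o); first lia.
  by exists (o + (2 * k - 1 - o) - k), (i + k - 1), (q - 1)%R; split; lia.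
exists (2 * k - 1 - i); first lia.
by exists (o + k - 1), (i + (2 * k - 1 - i) - k), (q + 1)%R; split; lia.
Qed.

Lemma solve_plain n :
  (forall X U S e z c, #|U :\: X| < n ->
     feasible k X U S e z c -> exists D : I -> T * T, solves k U S e z c D) ->
  forall s t U S e z c, #|S| < s -> zsum (z true) U + zsum (z false) U < t ->
  #|U| = n -> feasible k set0 U S e z c -> exists D, solves k U S e z c D.
Proof.
move=> IH; elim=> // s IHs; elim=> // t IHt U S e z c Ss zt Un F.
have [U1|U1] := leqP #|U| 1.
  exists e; split => [i iS|v vU]; first by rewrite /same_ends eqxx.
  have UE : U = [set v] by apply: card_le1_set1 => //; rewrite -leqNgt.
  have := fe_total F; rewrite UE !zsum1 csum1 => -[j Hj]; exists j; rewrite -Hj [net _ _ _]big1.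
    by rewrite add0r.
  by move=> i /(fe_within F); rewrite /flux UE => /andP[-> ->].
have [/existsP[B /existsP[u /and5P[sB B1 uU uB /goodP ng]]]|fatU] :=
  boolP [exists B : {set T}, exists u, [&& B \subset U, 1 < #|B|, u \in U,
    u \notin B & ~~ goodb k k k (wdeg S e z B) (csum c B)]].
  apply: (reduce F sB _ uU uB _ ng); rewrite ?setD0 ?inE ?Un //.
have {}fatU : fat k U S e z c.
  move=> B u sB B1 uU uB; apply/goodP; apply: contraNT fatU => ng.
  by apply/existsP; exists B; apply/existsP; exists u; rewrite sB B1 uU uB ng.
have [/exists_inP[x xU /andP[no1 no2]]|okU] :=
  boolP [exists x in U, ~~ ok k true S e z c x && ~~ ok k false S e z c x].
  have [u uU ux] : exists2 u, u \in U & u != x.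
    have /card_gt1P[a [b [aU bU ab]]] := U1.
    by have [E|] := eqVneq a x; [exists b; rewrite // -E eq_sym | exists a].
  have F' := zero_vertex_special k_gt2 F xU uU ux no1 no2.
  by apply: (IH _ _ _ _ _ _ _ F'); rewrite -Un [X in _ < X](cardsD1 x) xU.
have okN d v : v \in U -> ~~ ok k d S e z c v -> ok k (~~ d) S e z c v.
  move=> vU nod; apply: contraNT okU => nod'; apply/exists_inP; exists v => //.
  by case: d nod nod' => /= h1 h2; rewrite h1 h2.
have [/exists_inP[v vU /existsP[d /andP[zv okv]]]|noz] :=
  boolP [exists v in U, [exists d, (0 < z d v) && ok k d S e z c v]].
  have F' := delete_z k_gt2 F fatU vU zv okv.
  have [//||D sD] := IHt _ _ _ _ _ _ _ Un F'.
  - have := zsum_sub1 U zv; rewrite vU /updz.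
    by case: (d) => /=; move: zt; clear; lia.
  - by exists D; apply: delete_z_solves sD.
have {}noz d v : v \in U -> ok k d S e z c v -> z d v = 0.
  move=> vU okv; apply/eqP; apply: contraNT noz; rewrite -lt0n => zv.
  by apply/exists_inP; exists v => //; apply/existsP; exists d; rewrite zv.
have del d i u v j : i \in S -> u != v -> same_ends (e i) (u, v) ->
    small k (zsum (addz z d v j true) U) (zsum (addz z d v j false) U) ->
    ok k d S e z c u ->
    good k k.-1 k.-1 (wdeg S e z [set v] + j - 1) (c v + sg d * j.+1%:Z)%R ->
    exists D, solves k U S e z c D.
  move=> iS uv ei sm oku gv.
  have F' := delete_edge k_gt2 F fatU iS uv ei sm oku gv.
  have [|D sD] := IHs _ _ _ _ _ _ _ (ltnSn _) Un F'.
    by move: Ss; rewrite (cardsD1 i) iS.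
  exact: delete_edge_solves iS uv ei sD.
have [v0 v0U] : exists v, v \in U by apply/set0Pn; rewrite -card_gt0; lia.
have [d okd] : exists d, ok k d S e z c v0.
  by have [|/okN] := boolP (ok k true S e z c v0); [exists true | exists false; auto].
pose A := [set v in U | ok k d S e z c v].
have sA : A \subset U by apply/subsetP => v; rewrite inE => /andP[].
have v0A : v0 \in A by rewrite inE v0U.
have [/subsetP UA|/subsetPn[u uU uA]] := boolP (U \subset A); last first.
  have [i [a [b [iS aA bA eab]]]] := crossing_edge F sA v0A uU uA.
  move: aA bA; rewrite !inE => /andP[aU oka] /andP[]; rewrite negb_and => nb bU.
  rewrite bU /= in nb; apply: (del d i a b 0) => //.
  - by apply: contraNneq nb => <-.
  - have := fe_small F; rewrite !zsum_addz; do 2!case: ifP => _; by rewrite !addn0.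
  - rewrite -[in c b]csum1 csum1; apply: good_ok_other; apply/goodP.
    by have := okN d b bU nb; rewrite /ok; case: (d).
have okall v : v \in U -> ok k d S e z c v by move=> /UA; rewrite inE => /andP[].
have z0 : zsum (z d) U = 0 by apply: big1 => v vU; apply: noz => //; apply: okall.
have /card_gt1P[a [b [aU bU ab]]] := U1.
have [u uU uv0] : exists2 u, u \in U & u \notin [set v0].
  by have [E|] := eqVneq a v0; [exists b; rewrite // inE -E eq_sym | exists a; rewrite ?inE].
have sv0 : [set v0] \subset U by rewrite sub1set.
have [i [v [w [iS /set1P -> wU ei]]]] := crossing_edge F sv0 (set11 v0) uU uv0.
have {wU} [wv0 wU] : w != v0 /\ w \in U by move: wU; rewrite !inE => /andP[].
have /goodP/good_after_add[j jk gj] := okd.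
apply: (del d i w v0 j) => //.
- by move: ei; rewrite /same_ends /= orbC.
- have := fe_small F; rewrite !zsum_addz v0U andbT.
  move: z0 jk; clear -k_gt2; rewrite /small; case: (d) => /= ->; lia.
- exact: okall.
Qed.

Lemma solve_feasible n X U S e z c : #|U :\: X| = n -> feasible k X U S e z c ->
  exists D : I -> T * T, solves k U S e z c D.
Proof.
elim/ltn_ind: n => n IH in X U S e z c *; move=> Un F.
have IH' X' U' S' e' z' c' : #|U' :\: X'| < n -> feasible k X' U' S' e' z' c' ->
  exists D : I -> T * T, solves k U' S' e' z' c' D by move=> lt; apply: (IH _ lt).
have H0 U' S' e' z' c' : #|U'| = n -> feasible k set0 U' S' e' z' c' ->
  exists D : I -> T * T, solves k U' S' e' z' c' D.
  by move=> Un'; apply: (solve_plain IH' (ltnSn _) (ltnSn _) Un').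
have [X0|[x xX]] := set_0Vmem X; first by rewrite X0 setD0 in Un F; apply: H0 F.
have [_ EX _ [h [wx _]]] := fe_special F xX; rewrite EX in F Un.
exact: (solve_special (ltnW (ltnW k_gt2)) Un IH' H0 F wx).
Qed.

End ExtensionTheorem.

(** * Orientations without preoriented edges *)

Section Orientable.

Variables (T I : finType) (k : nat).
Hypothesis k_gt2 : 2 < k.
Implicit Types (S : {set I}) (e D : I -> T * T) (A B U X : {set T}).
Implicit Types (z : bool -> T -> nat) (c : T -> int) (d : bool).

Definition orientable U S e c :=
  exists2 D, orients S e D & forall v, v \in U -> cong k (net S D [set v]) (c v).

Definition zero_z : bool -> T -> nat := fun _ _ => 0.

Lemma zsum0 d A : zsum (zero_z d) A = 0.
Proof. exact: big1. Qed.

Lemma wdeg0 S e A : wdeg S e zero_z A = cut S e A.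
Proof. by rewrite /wdeg !zsum0 !addn0. Qed.

Lemma orientable_solves U S e c :
  (exists D, solves k U S e zero_z c D) -> orientable U S e c.
Proof. by move=> [D [oD sD]]; exists D => // v /sD; rewrite /zero_z addr0 subr0. Qed.

Lemma small0 : small k 0 0.
Proof. by rewrite /small; lia. Qed.

Lemma good_strong w x : good k k k w x -> good k k.-1 k.-1 w x.
Proof. by move=> [o [i [j [? ? ? ?]]]]; exists o, i, j; split; lia. Qed.

Lemma orientable_contract U S e c :
  within U S e -> cong k 0 (csum c U) ->
  (1 < #|U| -> forall v, v \in U -> good k k.-1 k.-1 (cut S e [set v]) (c v)) ->
  (forall B a, B \subset U -> a \in B -> 1 < #|B| < #|U| ->
     orientable (a |: (U :\: B)) S (collapse_ends B a e) (collapse_c B a c)) ->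
  orientable U S e c.
Proof.
move=> HU tot gv contr.
pose bad B := [&& B \subset U, B != set0, B != U & ~~ goodb k k.-1 k.-1 (cut S e B) (csum c B)].
have [[B0 bad0]|nobad] := altP (@existsP _ bad); last first.
  apply/orientable_solves/(solve_feasible k_gt2 (erefl #|U :\: set0|)); split.
  - exact: HU.
  - by rewrite !zsum0 small0.
  - by rewrite !zsum0.
  - move=> A u v sA vA _ uU uA _; rewrite wdeg0; apply/goodP.
    apply: contraNT nobad => ng; apply/existsP; exists A; rewrite /bad sA ng andbT /=.
    apply/andP; split; first by apply/set0Pn; exists v.
    by apply: contraNneq uA => ->.
  - by move=> x; rewrite inE.
pose B := [arg min_(B < B0 | bad B) #|B|].
have [badB minB] : bad B /\ forall A, bad A -> #|B| <= #|A|.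
  by rewrite /B; case: arg_minnP.
have {badB} /and4P[sB /set0Pn[a aB] BU /goodP ng] := badB.
have ltB : #|B| < #|U| by apply: proper_card; rewrite properEneq BU.
have B1 : 1 < #|B|.
  rewrite ltnNge; apply/negP => B1; apply: ng.
  have E : B = [set a] by apply: card_le1_set1; rewrite // -leqNgt.
  rewrite {1}E E csum1; apply: gv; last exact: (subsetP sB).
  by have := subset_leq_card sB; rewrite E cards1 => _; move: ltB; rewrite E cards1.
have [D1 oD1 sD1] := contr B a sB aB (introT andP (conj B1 ltB)).
have sol1 : solves k (a |: (U :\: B)) S (collapse_ends B a e) (collapse_z B a zero_z)
    (collapse_c B a c) D1.
  split=> // v /sD1 Hv; suff E d : collapse_z B a zero_z d v = 0 by rewrite !E addr0 subr0.
  by rewrite /collapse_z zsum0; case: ifP.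
have [z2 [w2 t2 sol2]] := glue HU sB aB sol1.
have [D2 s2] : exists D2, solves k B (inner S e B) e z2 c D2.
  apply: (solve_feasible k_gt2 (erefl #|B :\: set0|)); split.
  - by move=> i; rewrite inE => /andP[].
  - apply: not_good_small t2 _ (fun g => ng (good_strong g)).
    rewrite -wdeg0 -(w2 B (subxx _)) /wdeg.
    rewrite [cut _ _ _]big1 // => i; rewrite inE => /andP[_ /andP[h1 h2]].
    by rewrite /crosses h1 h2.
  - exact: t2.
  - move=> A u v sA vA _ uB uA _; rewrite w2 // wdeg0; apply/goodP.
    apply: contraT => ngA; suff /minB : bad A.
      by rewrite leqNgt proper_card //; apply/properP; split => //; exists u.
    rewrite /bad (subset_trans sA sB) ngA andbT /=; apply/andP; split.
      by apply/set0Pn; exists v.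
    apply: contraNneq uA => ->; exact: (subsetP sB).
  - by move=> x; rewrite inE.
exact/orientable_solves/(sol2 _ s2).
Qed.

Lemma orientable_le1 U S e c : within U S e -> cong k 0 (csum c U) -> #|U| <= 1 ->
  orientable U S e c.
Proof.
move=> HU tot U1; apply: orientable_contract => // [|B a _ _ /andP[B1 BU]]; lia.
Qed.

Lemma collapse_mem U B a A w : A \subset a |: (U :\: B) -> a \in B ->
  (collapse B a w \in A) = (w \in (if a \in A then A :|: B else A)).
Proof.
move=> sA aB; rewrite /collapse; case: ifP => wB; case: ifP => aA; rewrite ?inE ?wB ?orbT ?orbF //.
apply/esym; apply: contraFF aA => wA.
by have := subsetP sA _ wA; rewrite !inE wB orbF => /eqP <-.
Qed.

Lemma collapse_csum_total U B a c : B \subset U -> a \in B ->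
  csum (collapse_c B a c) (a |: (U :\: B)) = csum c U.
Proof.
move=> sBU aB; rewrite /csum (collapse_sum _ (subxx _) aB) setU11 /csum.
suff -> : (a |: U :\: B) :|: B = U by [].
apply/setP => v; rewrite !inE.
case: eqP => [->|_] /=; first by rewrite (subsetP sBU).
by case: (boolP (v \in B)) => [/(subsetP sBU) ->|]; rewrite ?andbF ?orbF.
Qed.

Lemma collapse_card U B a : B \subset U -> a \in B -> 1 < #|B| ->
  #|a |: (U :\: B)| < #|U|.
Proof.
move=> sBU aB B1; rewrite cardsU1 cardsD (setIidPr sBU) !inE aB.
have := subset_leq_card sBU; lia.
Qed.

End Orientable.

Lemma subset_of_card (T : finType) (E : {set T}) n : n <= #|E| ->
  exists2 O : {set T}, O \subset E & #|O| = n.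
Proof.
move=> nE; exists [set x in take n (enum E)].
  by apply/subsetP => x; rewrite inE => /mem_take; rewrite mem_enum.
rewrite cardsE (card_uniqP (take_uniq _ (enum_uniq _))) size_take -cardE.
by case: ltngtP nE.
Qed.

Section VertexRemoval.

Variables (T I : finType) (k : nat).
Implicit Types (S : {set I}) (e D : I -> T * T) (A B U X : {set T}).
Implicit Types (c : T -> int).

Definition parity U S e c := forall v, v \in U -> exists q : int, (c v = (cut S e [set v])%:Z + 2 * q)%R.

Lemma net_parity S e D A : orients S e D ->
  exists q : int, (net S D A = (cut S e A)%:Z + 2 * q)%R.
Proof.
move=> oD; exists (- \sum_(i in S) ((((D i).1 \notin A) && ((D i).2 \in A)) : nat)%:Z)%R.
rewrite /net /cut Posz_sum mulrN mulr_sumr -sumrB; apply: eq_bigr => i /oD oi.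
by rewrite (same_ends_cross A oi) /flux /crosses; case: (_ \in A); case: (_ \in A).
Qed.

Lemma parity_set U S e c A : parity U S e c -> A \subset U ->
  exists q : int, (csum c A = (cut S e A)%:Z + 2 * q)%R.
Proof.
move=> par sA; have oe : orients S e e by move=> i _; rewrite /same_ends eqxx.
have [q Eq] := net_parity A oe; rewrite -sum_net in Eq.
suff [r Er] : exists r : int, (csum c A = \sum_(v in A) net S e [set v] + 2 * r)%R.
  by exists (q + r)%R; rewrite Er Eq; lia.
rewrite /csum; apply: (big_ind2 (fun x y => exists r : int, x = y + 2 * r)%R).
- by exists 0%R.
- by move=> x1 x2 y1 y2 [r1 ->] [r2 ->]; exists (r1 + r2)%R; lia.
- move=> v /(subsetP sA) /par [r ->]; have [q' Eq'] := net_parity [set v] oe.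
  by exists (r - q')%R; rewrite Eq'; lia.
Qed.

Lemma cut_inner_split S e U v : within U S e ->
  S :\: inner S e (U :\ v) = [set i in S | ((e i).1 == v) || ((e i).2 == v)].
Proof.
move=> HU; apply/setP => i; rewrite !inE; case: (boolP (i \in S)) => iS; last by rewrite andbF.
by have /andP[-> ->] := HU i iS; rewrite !andbT /= negb_and !negbK.
Qed.

Hypothesis k_gt0 : 0 < k.

Lemma orient_vertex U S e c v : v \in U -> within U S e ->
  cong k 0 (csum c U) -> parity U S e c -> k.-1 <= cut S e [set v] ->
  (forall c', cong k 0 (csum c' (U :\ v)) -> parity (U :\ v) (inner S e (U :\ v)) e c' ->
     orientable k (U :\ v) (inner S e (U :\ v)) e c') ->
  orientable k U S e c.
Proof.
move=> vU HU [j0 tot] par kw IH.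
pose S2 := inner S e (U :\ v); pose R := S :\: S2.
have sS2 : S2 \subset S by apply/subsetP => i; rewrite inE => /andP[].
have RE i : i \in R -> i \in S /\ (((e i).1 == v) || ((e i).2 == v)).
  by rewrite /R cut_inner_split // inE => /andP[].
pose oth i := if (e i).1 == v then (e i).2 else (e i).1.
have othE i : i \in R -> same_ends (e i) (v, oth i).
  move=> /RE [iS]; rewrite /oth /same_ends; case: (e i) => a b /=.
  by case: eqP => [->|_] /=; rewrite ?eqxx // => /eqP ->; rewrite eqxx orbT.
pose E := [set i in S | crosses [set v] (e i)].
have cardE : #|E| = cut S e [set v] by rewrite /cut -sum1dep_card big_mkcondr.
have ER i : i \in R -> (i \in E) = (oth i != v).
  move=> iR; have [iS _] := RE i iR; rewrite inE iS (same_ends_cross _ (othE i iR)).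
  by rewrite /crosses !inE eqxx.
have sER : E \subset R.
  apply/subsetP => i; rewrite inE /R cut_inner_split // inE => /andP[-> ].
  by rewrite /crosses !inE; do 2!case: (_ == v).
have [q0 Eq0] := par v vU; set w := cut S e [set v] in kw Eq0 cardE.
have [o ow [t Ho]] : exists2 o : nat, o <= w & exists t : int, (w%:Z + q0 = o%:Z + t * k%:Z)%R.
  have k0 : (k%:Z != 0)%R by lia.
  have g0 := modz_ge0 (w%:Z + q0)%R k0.
  have kp : (0 < k%:Z)%R by lia.
  have lt := ltz_pmod (w%:Z + q0)%R kp.
  exists `|((w%:Z + q0) %% k%:Z)%Z|%N; first lia.
  exists ((w%:Z + q0) %/ k%:Z)%Z; have := divz_eq (w%:Z + q0)%R k%:Z; lia.
have [O sO cO] : exists2 O : {set I}, O \subset E & #|O| = o.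
  by apply: subset_of_card; rewrite cardE.
pose Dv i := if i \in O then (v, oth i) else (oth i, v).
have oDv : orients R e Dv.
  move=> i iR; rewrite /Dv; case: ifP => _; have := othE i iR => //.
  by rewrite /same_ends /= orbC.
have netv : (net R Dv [set v] = o%:Z *+ 2 - w%:Z)%R.
  rewrite -cO -cardE -!sum1_card !Posz_sum /net.
  rewrite (big_setID E) /= (setIidPr sER) [X in (_ + X)%R]big1 ?addr0; last first.
    move=> i; rewrite inE => /andP[iE iR]; rewrite ER // negbK in iE.
    by rewrite /Dv (eqP iE); case: ifP => _; rewrite /flux subrr.
  rewrite (big_setID O) /= (setIidPr sO) [X in (_ - X)%R](big_setID O) /= (setIidPr sO).
  rewrite -sumrMnl opprD addrA -sumrB -sumrN; congr (_ + _)%R.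
    apply: eq_bigr => i iO; rewrite /Dv iO /flux /= !inE eqxx.
    have iE := subsetP sO _ iO; have := ER i (subsetP sER _ iE); rewrite iE => /esym.
    by move=> /negbTE ->.
  apply: eq_bigr => i; rewrite inE => /andP[iO iE]; rewrite /Dv (negbTE iO) /flux /= !inE eqxx.
  by have := ER i (subsetP sER _ iE); rewrite iE => /esym /negbTE ->.
have DvU i : i \in R -> (Dv i).1 \in U /\ (Dv i).2 \in U.
  move=> iR; have [iS _] := RE i iR; have := HU i iS.
  by case/orP: (oDv i iR) => /eqP -> /= /andP[].
have netU : (net R Dv [set v] + net R Dv (U :\ v) = 0)%R.
  rewrite -[net R Dv (U :\ v)]sum_net -(big_setD1 v) //= sum_net; apply: big1 => i iR.
  by have [h1 h2] := DvU i iR; rewrite /flux h1 h2.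
have [D2 oD2 sD2] : orientable k (U :\ v) S2 e (fun u => c u - net R Dv [set u])%R.
  apply: IH.
    exists (j0 + t)%R; rewrite /csum sumrB sum_net.
    move: tot netU; rewrite netv /csum (big_setD1 v) //= Eq0 mulr2n.
    move: (\sum_(_ in _) _)%R (net _ _ _) => s1 s2; move: Ho; clear; lia.
  move=> u; rewrite inE => /andP[uv uU]; have [q Eq] := par u uU.
  have [r Er] := net_parity [set u] oDv.
  exists (q - r)%R; rewrite Eq Er /cut (big_setID S2) /= (setIidPr sS2) -/R -/S2.
  by rewrite PoszD; lia.
pose D i := if i \in S2 then D2 i else Dv i.
have netD A : net S D A = (net S2 D2 A + net R Dv A)%R.
  rewrite /net (big_setID S2) /= (setIidPr sS2) -/R; congr (_ + _)%R.
    by apply: eq_bigr => i iS2; rewrite /D iS2.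
  by apply: eq_bigr => i; rewrite inE => /andP[/negbTE iS2 _]; rewrite /D iS2.
exists D => [i iS|u uU].
  rewrite /D; case: ifP => iS2; first exact: oD2.
  by apply: oDv; rewrite inE iS2.
rewrite netD; have [->|uv] := eqVneq u v.
  have -> : net S2 D2 [set v] = 0%R.
    apply: big1 => i iS2; have := iS2; rewrite inE !in_setD1 => /andP[iS].
    have := oD2 i iS2; rewrite /same_ends /flux => /orP[] /eqP -> /= /andP[] /andP[h1 _] /andP[h2 _];
      by rewrite !inE (negbTE h1) (negbTE h2).
  exists (- t)%R; rewrite netv Eq0; move: Ho; clear; lia.
have [|j Hj] := sD2 u; first by rewrite !inE uv.
by exists j; rewrite Hj; lia.
Qed.

End VertexRemoval.

(** * Disjoint connected classes *)

Section Joined.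

Variables (T I : finType).
Implicit Types (S : {set I}) (e : I -> T * T) (A B U : {set T}) (P : pred I).

Definition joined U S e P := forall A u v, A \subset U -> u \in A -> v \in U -> v \notin A ->
  exists i, [/\ i \in S, P i & crosses A (e i)].

Lemma crosses_setC U A (p : T * T) : p.1 \in U -> p.2 \in U ->
  crosses (U :\: A) p = crosses A p.
Proof. by rewrite /crosses !inE => -> ->; case: (_ \in A); case: (_ \in A). Qed.

Lemma joined_avoiding U S e P v : within U S e -> v \in U ->
  (forall A u, A \subset U -> u \in A -> v \notin A ->
     exists i, [/\ i \in S, P i & crosses A (e i)]) -> joined U S e P.
Proof.
move=> HU vU H A u w sA uA wU wA.
have [vA|] := boolP (v \in A); last by move=> vA; apply: H sA uA vA.
have [||i [iS Pi cr]] := H (U :\: A) w (subsetDl _ _); rewrite ?inE ?wA ?vA //.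
by exists i; split => //; have /andP[h1 h2] := HU i iS; rewrite -(crosses_setC A h1 h2).
Qed.

Lemma upd_within U S e i p j : within U S e -> p.1 \in U -> p.2 \in U ->
  within U (S :\ j) (upd e i p).
Proof.
by move=> HU h1 h2 l; rewrite !inE /upd => /andP[_ lS]; case: eqP => _; [rewrite h1 h2 | apply: HU].
Qed.

(* If neither lift kept the class connected, the two violated cuts would
   intersect in a violated cut of the original class. *)
Lemma lift_joined U S e P v i1 i2 j x1 x2 y : within U S e -> v \in U -> y \in U ->
  i1 \in S -> i2 \in S -> i1 != i2 -> P i1 -> P i2 -> ~~ P j ->
  same_ends (e i1) (v, x1) -> same_ends (e i2) (v, x2) ->
  joined U S e P ->
  joined U (S :\ j) (upd e i1 (x1, y)) P \/ joined U (S :\ j) (upd e i2 (x2, y)) P.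
Proof.
move=> HU vU yU i1S i2S i12 P1 P2 Pj e1 e2 jP.
have xU i x : i \in S -> same_ends (e i) (v, x) -> x \in U.
  by move=> /HU /andP[h1 h2] /orP[] /eqP E; rewrite E in h1 h2.
have W i x : i \in S -> same_ends (e i) (v, x) -> within U (S :\ j) (upd e i (x, y)).
  by move=> iS ei; apply: upd_within => //; apply: xU ei.
pose viol i x A := [&& A \subset U, A != set0, v \notin A &
  ~~ [exists l in S :\ j, P l && crosses A (upd e i (x, y) l)]].
have dich i x : i \in S -> same_ends (e i) (v, x) ->
    joined U (S :\ j) (upd e i (x, y)) P \/ exists A, viol i x A.
  move=> iS ei; have [[A HA]|nex] := altP (@existsP _ (viol i x)); first by right; exists A.
  left; apply: (joined_avoiding (W i x iS ei) vU) => A u sA uA vA.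
  move: nex; rewrite negb_exists => /forallP/(_ A).
  rewrite /viol sA vA /=; have -> /= : A != set0 by apply/set0Pn; exists u.
  by rewrite negbK => /exists_inP[l lS /andP[Pl cr]]; exists l.
have [|[A /and4P[sA A0 vA nA]]] := dich i1 x1 i1S e1; first by left.
have [|[B /and4P[sB B0 vB nB]]] := dich i2 x2 i2S e2; first by right.
exfalso.
have key i x (C : {set T}) : i \in S -> P i -> same_ends (e i) (v, x) -> C \subset U -> C != set0 ->
    v \notin C -> ~~ [exists l in S :\ j, P l && crosses C (upd e i (x, y) l)] ->
    y \in C /\ forall l, l \in S -> P l -> crosses C (e l) -> l = i.
  move=> iS Pi ei sC /set0Pn[u uC] vC nC.
  have only l : l \in S -> P l -> crosses C (e l) -> l = i.
    move=> lS Pl cr; apply/eqP; apply: contraNT nC => li; apply/exists_inP; exists l.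
      by rewrite !inE lS andbT; apply: contraNneq Pj => <-.
    by rewrite Pl /upd (negbTE li).
  split => //; have [l [lS Pl cr]] := jP C u v sC uC vU vC.
  have E := only l lS Pl cr; rewrite E (same_ends_cross C ei) /crosses (negbTE vC) /= in cr.
  apply: contraNT nC => yC; apply/exists_inP; exists i.
    by rewrite !inE iS andbT; apply: contraNneq Pj => <-.
  by rewrite Pi /upd eqxx /crosses /= cr (negbTE yC).
have [yA oA] := key _ _ _ i1S P1 e1 sA A0 vA nA.
have [yB oB] := key _ _ _ i2S P2 e2 sB B0 vB nB.
have [|||| l [lS Pl cr]] := jP (A :&: B) y v; rewrite ?inE ?yA ?yB ?negb_and ?vA //.
  exact: subset_trans (subsetIl _ _) sA.
have h x (C : {set T}) : v \notin C -> crosses C (v, x) = (x \in C) by rewrite /crosses /= => /negbTE ->.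
have vAB : v \notin A :&: B by rewrite inE negb_and vA.
have [crA|ncrA] := boolP (crosses A (e l)).
  have E := oA l lS Pl crA; rewrite {}E in cr crA lS.
  rewrite (same_ends_cross _ e1) h // inE in cr; have /andP[_ xB] := cr.
  have := oB i1 i1S P1; rewrite (same_ends_cross _ e1) h // => /(_ xB) E.
  by rewrite E eqxx in i12.
have crB : crosses B (e l).
  move: ncrA cr; rewrite /crosses !inE.
  by do 2!case: (_ \in A); do 2!case: (_ \in B).
have E := oB l lS Pl crB; rewrite {}E in cr crB lS.
rewrite (same_ends_cross _ e2) h // inE in cr; have /andP[xA _] := cr.
have := oA i2 i2S P2; rewrite (same_ends_cross _ e2) h // => /(_ xA) E.
by rewrite E eqxx in i12.
Qed.

Lemma joined_leaf U S e P v : within U S e -> v \in U -> joined U S e P ->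
  cut [set i in S | P i] e [set v] <= 1 ->
  joined (U :\ v) (inner S e (U :\ v)) e P.
Proof.
move=> HU vU jP d1 A u w sA uA; rewrite inE => /andP[]; rewrite inE => wv wU wA.
have sAU := subset_trans sA (subsetDl _ _).
have vA : v \notin A by apply/negP => /(subsetP sA); rewrite !inE eqxx.
have inn i : i \in S -> (i \in inner S e (U :\ v)) = ((e i).1 != v) && ((e i).2 != v).
  by move=> iS; rewrite !inE iS; have /andP[-> ->] := HU i iS; rewrite !andbT.
have [i [iS Pi cr]] := jP A u v sAU uA vU vA.
have [iI|iI] := boolP (i \in inner S e (U :\ v)); first by exists i.
have [||||i2 [i2S P2 cr2]] := jP (v |: A) v w; rewrite ?inE ?eqxx ?negb_or ?wv ?wU //.
  by rewrite subUset sub1set vU.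
have [i2I|i2I] := boolP (i2 \in inner S e (U :\ v)).
  exists i2; split => //; move: cr2; rewrite inn // in i2I; case/andP: i2I => h1 h2.
  by rewrite /crosses !inE (negbTE h1) (negbTE h2).
have memA x : (x \in A) ==> (x != v) by apply/implyP; apply: contraTneq => ->.
have ci : crosses [set v] (e i).
  rewrite inn // negb_and !negbK in iI; move: iI cr; rewrite /crosses !inE.
  have := @memA (e i).1; have := @memA (e i).2.
  by case: ((e i).1 == v); case: ((e i).2 == v); case: ((e i).1 \in A); case: ((e i).2 \in A).
have ci2 : crosses [set v] (e i2).
  rewrite inn // negb_and !negbK in i2I; move: i2I cr2; rewrite /crosses !inE.
  by do 2!case: (_ == v).
have E : i = i2.
  apply/eqP; apply: contraTT d1 => ne; rewrite -ltnNge /cut.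
  rewrite (bigD1 i) ?inE ?iS //= (bigD1 i2) /= ?inE ?i2S ?P2 1?eq_sym //.
  by rewrite ci ci2 addnA leq_addr.
exfalso; move: ci cr cr2; rewrite -E /crosses !inE.
have := @memA (e i).1; have := @memA (e i).2.
by case: ((e i).1 == v); case: ((e i).2 == v); case: ((e i).1 \in A); case: ((e i).2 \in A).
Qed.

End Joined.

Section TreeConnected.

Variables (T I : finType) (k m : nat) (col : I -> option 'I_m).
Hypothesis k_gt2 : 2 < k.
Implicit Types (S : {set I}) (e D : I -> T * T) (A B U X : {set T}) (P : pred I).
Implicit Types (c : T -> int) (Fin : {set 'I_m}).

Let k_gt0 : 0 < k := ltnW (ltnW k_gt2).

Definition coloured (j : 'I_m) : pred I := fun i => col i == Some j.
Definition class_deg S e v j := cut [set i in S | coloured j i] e [set v].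

Lemma cut_card S e A : cut S e A = #|[set i in S | crosses A (e i)]|.
Proof. by rewrite /cut -sum1dep_card big_mkcondr. Qed.

Lemma crosses1P v (p : T * T) : crosses [set v] p -> exists2 x, x != v & same_ends p (v, x).
Proof.
rewrite /crosses !inE; have [E|n] := eqVneq p.1 v => /= h.
  by exists p.2; rewrite // -E /same_ends -surjective_pairing eqxx.
exists p.1 => //; have {h} /eqP <- : p.2 == v by [].
by rewrite /same_ends /= -surjective_pairing eqxx orbT.
Qed.

Lemma class_deg_sum S e v (J : {set 'I_m}) :
  \sum_(j in J) class_deg S e v j =
  \sum_(i in S) (if [exists j in J, coloured j i] then (crosses [set v] (e i) : nat) else 0).
Proof.
transitivity (\sum_(j in J) \sum_(i in S) (if coloured j i then (crosses [set v] (e i) : nat) else 0)).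
  by apply: eq_bigr => j _; rewrite -big_mkcondr; apply: eq_bigl => i; rewrite inE.
rewrite exchange_big; apply: eq_bigr => i iS /=.
case: ifP => [/exists_inP[j jJ ij]|/negbT/exists_inPn no].
  rewrite (bigD1 j) //= ij big1 ?addn0 // => j' /andP[_ j'j].
  case: ifP => // /eqP E; move: ij; rewrite /coloured E => /eqP[E2].
  by rewrite E2 eqxx in j'j.
by rewrite big1 // => j jJ; rewrite (negbTE (no j jJ)).
Qed.

(* Fin collects the classes that are connected without v.  The degree bound
   always leaves an edge at v outside the other classes, against which an edge of
   an unfinished class can be split off. *)
Lemma split_vertex U v : v \in U ->
  (forall S e c, within (U :\ v) S e -> cong k 0 (csum c (U :\ v)) ->
     parity (U :\ v) S e c -> (forall j, joined (U :\ v) S e (coloured j)) ->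
     orientable k (U :\ v) S e c) ->
  forall N S e Fin c, #|S| + #|~: Fin| < N -> within U S e ->
    cong k 0 (csum c U) -> parity U S e c ->
    (forall j, j \in Fin -> joined (U :\ v) (inner S e (U :\ v)) e (coloured j)) ->
    (forall j, j \notin Fin -> joined U S e (coloured j)) ->
    2 * (\sum_(j in ~: Fin) (class_deg S e v j).-1) + k.-1 <= cut S e [set v] ->
    orientable k U S e c.
Proof.
move=> vU IH; elim=> // N IHN S e Fin c; rewrite ltnS => SN HU tot par jF jN dv.
have [F0|[j0 j0F]] := set_0Vmem (~: Fin).
  apply: (orient_vertex k_gt0 vU HU tot par).
    by apply: leq_trans dv; rewrite leq_addl.
  move=> c' tot' par'; apply: IH => // [i|j]; first by rewrite inE => /andP[].
  by apply: jF; move/setP: F0 => /(_ j); rewrite !inE => /negbFE.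
have [/exists_inP[j jN1 jd]|all2] := boolP [exists j in ~: Fin, class_deg S e v j <= 1].
  rewrite inE in jN1; apply: (IHN S e (j |: Fin) c) => //.
  - have : #|~: (j |: Fin)| < #|~: Fin|; last by move: SN; clear; lia.
    by rewrite setCU setIC -setDE [X in _ < X](cardsD1 j) inE jN1.
  - move=> j'; rewrite !inE => /orP[/eqP ->|]; last exact: jF.
    by apply: joined_leaf => //; apply: jN.
  - by move=> j'; rewrite !inE negb_or => /andP[_]; apply: jN.
  - apply: leq_trans dv; rewrite leq_add2r leq_mul2l /=.
    rewrite setCU setIC -setDE [X in _ <= X](big_setD1 j) /= ?inE //.
    exact: leq_addl.
have {}all2 j : j \notin Fin -> 1 < class_deg S e v j.
  move=> jF'; rewrite ltnNge; apply: contraNN all2 => h; apply/exists_inP.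
  by exists j; rewrite ?inE.
rewrite inE in j0F.
have : 1 < #|[set i in [set i in S | coloured j0 i] | crosses [set v] (e i)]|.
  by rewrite -cut_card; apply: all2.
case/card_gt1P => i1 [i2 []]; rewrite !inE => /andP[/andP[i1S P1] cr1] /andP[/andP[i2S P2] cr2] i12.
have [x1 x1v e1] := crosses1P cr1; have [x2 x2v e2] := crosses1P cr2.
have /exists_inP[i3 i3S /andP[cr3 /exists_inPn nP3]] :
    [exists i in S, crosses [set v] (e i) && ~~ [exists j in ~: Fin, coloured j i]].
  apply: contraLR isT => /exists_inPn none; exfalso.
  have : cut S e [set v] <= \sum_(j in ~: Fin) class_deg S e v j.
    rewrite class_deg_sum; apply: leq_sum => i iS; have := none i iS.
    by case: (crosses _ _) => //=; rewrite negbK => ->.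
  have : \sum_(j in ~: Fin) class_deg S e v j <= 2 * \sum_(j in ~: Fin) (class_deg S e v j).-1.
    rewrite big_distrr /=; apply: leq_sum => j; rewrite inE => /all2; clear; lia.
  by move: dv (k_gt2); clear; lia.
have [y yv e3] := crosses1P cr3.
have nP j : j \notin Fin -> ~~ coloured j i3 by move=> jF'; apply: nP3; rewrite inE.
have memU i x : i \in S -> same_ends (e i) (v, x) -> x \in U.
  by move=> /HU /andP[h1 h2] /orP[] /eqP E; rewrite E in h1 h2.
have yU := memU _ _ i3S e3.
suff fin i x : i \in S -> coloured j0 i -> x != v -> same_ends (e i) (v, x) ->
    joined U (S :\ i3) (upd e i (x, y)) (coloured j0) -> orientable k U S e c.
  have [h|h] := lift_joined HU vU yU i1S i2S i12 P1 P2 (nP j0 j0F) e1 e2 (jN j0 j0F).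
    exact: (fin i1 x1).
  exact: (fin i2 x2).
move=> iS Pi xv ei jnew.
have i3i : i != i3 by apply: contraTneq Pi => ->; apply: nP.
have lc A := lift_cut A iS i3S i3i ei e3.
have cutv : cut S e [set v] = cut (S :\ i3) (upd e i (x, y)) [set v] + 2.
  by rewrite lc !inE eqxx (negbTE xv) (negbTE yv).
have touch l z : same_ends (e l) (v, z) -> l \in inner S e (U :\ v) = false.
  by rewrite !inE; case/orP => /eqP -> /=; rewrite eqxx ?andbF.
have [D oD sD] : orientable k U (S :\ i3) (upd e i (x, y)) c; last first.
  have [D' [oD' nD']] := lift_net iS i3S i3i ei e3 oD.
  by exists D' => // u uU; rewrite nD'; apply: sD.
apply: (IHN _ _ Fin) => //.
- by move: SN; rewrite (cardsD1 i3 S) i3S; clear; lia.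
- by apply: upd_within => //; apply: memU ei.
- move=> u /par [q Eq]; rewrite Eq lc; move: (nat_of_bool _) (cut _ _ _) => b w.
  by exists (q + b%:Z)%R; clear; lia.
- move=> j jFj A u w sA uA wU wA; have [l [lI Pl cr]] := jF j jFj A u w sA uA wU wA.
  have li : l != i by apply: contraTneq lI => ->; rewrite (touch _ _ ei).
  have l3 : l != i3 by apply: contraTneq lI => ->; rewrite (touch _ _ e3).
  exists l; rewrite Pl /upd (negbTE li); split => //.
  by move: lI; rewrite !inE l3 /upd (negbTE li).
- move=> j jFj A u w sA uA wU wA; have [->|jj0] := eqVneq j j0; first exact: jnew uA wU wA.
  have [l [lI Pl cr]] := jN j jFj A u w sA uA wU wA.
  have li : l != i.
    by apply: contraNneq jj0 => E; move: Pl; rewrite E /coloured (eqP Pi) => /eqP [->].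
  have l3 : l != i3 by apply: contraTneq Pl => ->; apply: nP.
  by exists l; rewrite Pl /upd (negbTE li) !inE l3.
- have dj j : j \notin Fin -> class_deg S e v j =
      class_deg (S :\ i3) (upd e i (x, y)) v j + (j == j0).
    move=> jFj; have -> : class_deg (S :\ i3) (upd e i (x, y)) v j =
        cut [set l in S | coloured j l] (upd e i (x, y)) [set v].
      rewrite /class_deg; congr (cut _ _ _); apply/setP => l; rewrite !inE.
      by case: eqVneq => [->|] //=; rewrite (negbTE (nP j jFj)) andbF.
    rewrite /class_deg /cut; case: eqVneq => [->|jj0] /=.
      have iC : i \in [set l in S | coloured j0 l] by rewrite inE iS.
      rewrite !(big_setD1 i iC) /= /upd eqxx (same_ends_cross _ ei) /crosses /= !inE eqxx.
      rewrite (negbTE xv) (negbTE yv) /= add0n addn1 add1n; congr _.+1.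
      by apply: eq_bigr => l; rewrite !inE => /andP[/negbTE -> _].
    rewrite addn0; apply: eq_bigr => l; rewrite !inE => /andP[_ Pl].
    rewrite /upd; case: eqP => // E; move: Pl; rewrite E /coloured (eqP Pi) => /eqP [Ej].
    by rewrite Ej eqxx in jj0.
  move: dv; rewrite cutv.
  rewrite !(big_setD1 (A := ~: Fin) j0) ?inE //=.
  have -> : \sum_(j in (~: Fin) :\ j0) (class_deg S e v j).-1 =
      \sum_(j in (~: Fin) :\ j0) (class_deg (S :\ i3) (upd e i (x, y)) v j).-1.
    by apply: eq_bigr => j; rewrite !inE => /andP[/negbTE jj0 jFj]; rewrite (dj j jFj) jj0 addn0.
  have := all2 j0 j0F; rewrite (dj j0 j0F) eqxx.
  by move: (class_deg _ _ _ _) (\sum_(_ in _) _) (cut _ _ _); clear; lia.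
Qed.

End TreeConnected.

Section TreeTheorem.

Variables (T I : finType) (k : nat).
Hypothesis k_gt2 : 2 < k.
Implicit Types (S : {set I}) (e D : I -> T * T) (A B U X : {set T}) (P : pred I).
Implicit Types (c : T -> int).

Lemma good_large (w : nat) (q : int) : 3 * k - 3 <= w -> good k k.-1 k.-1 w (w%:Z + 2 * q)%R.
Proof.
move=> w3; have kp : (0 < k%:Z)%R by lia.
have k0 : (k%:Z != 0)%R by lia.
pose s := (- q - k.-1%:Z)%R.
have g0 := modz_ge0 s k0; have lt := ltz_pmod s kp; have dv := divz_eq s k%:Z.
exists (w - (k.-1 + `|(s %% k%:Z)%Z|)), (k.-1 + `|(s %% k%:Z)%Z|), (s %/ k%:Z)%Z.
move: (s %% k%:Z)%Z (s %/ k%:Z)%Z g0 lt dv => r t g0 lt; rewrite /s => dv.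
by clear s; split; lia.
Qed.

Lemma collapse_cut U S e B a A : A \subset a |: (U :\: B) -> a \in B ->
  cut S (collapse_ends B a e) A = cut S e (if a \in A then A :|: B else A).
Proof.
move=> sA aB; apply: eq_bigr => i _.
by rewrite /crosses /= !(collapse_mem _ sA aB).
Qed.

Lemma collapse_cut1 U S e B a v : B \subset U -> a \in B -> v \in a |: (U :\: B) ->
  cut S (collapse_ends B a e) [set v] = cut S e (if v == a then B else [set v]).
Proof.
move=> sB aB vU; rewrite (collapse_cut _ _ (U := U) (B := B)) ?sub1set // inE eq_sym.
case: eqP => // ->; congr (cut _ _ _); apply/setP => w; rewrite !inE.
by case: eqP => // ->; rewrite aB.
Qed.

Lemma collapse_joined U S e B a P : B \subset U -> a \in B -> joined U S e P ->
  joined (a |: (U :\: B)) S (collapse_ends B a e) P.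
Proof.
move=> sB aB jP A u w sA uA wU wA.
set A' := if a \in A then A :|: B else A.
have sU1 : a |: (U :\: B) \subset U by rewrite subUset sub1set (subsetP sB) // subsetDl.
have sA' : A' \subset U.
  by rewrite /A'; case: ifP => _; rewrite ?subUset ?sB ?andbT (subset_trans sA).
have uA' : u \in A' by rewrite /A'; case: ifP => _; rewrite ?inE uA.
have wA' : w \notin A'.
  rewrite /A'; case: ifP => aA //; rewrite inE negb_or wA /=.
  move: wU; rewrite !inE => /orP[/eqP E|/andP[] //].
  by rewrite E aA in wA.
have [i [iS Pi cr]] := jP A' u w sA' uA' (subsetP sU1 _ wU) wA'.
by exists i; split => //; rewrite /crosses /= !(collapse_mem _ sA aB).
Qed.

Lemma collapse_parity U S e c B a : B \subset U -> a \in B -> parity U S e c ->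
  parity (a |: (U :\: B)) S (collapse_ends B a e) (collapse_c B a c).
Proof.
move=> sB aB par v vU; rewrite (collapse_cut1 S e sB aB vU) /collapse_c.
case: eqP vU => [_ _|/eqP va]; first exact: parity_set par sB.
by rewrite !inE (negbTE va) => /andP[_]; apply: par.
Qed.

Lemma orientable_joined U S e c (col : I -> option 'I_(2 * k - 2)) :
  within U S e -> cong k 0 (csum c U) -> parity U S e c ->
  (forall j, joined U S e (coloured col j)) -> orientable k U S e c.
Proof.
move En : #|U| => n; elim/ltn_ind: n => n IH in U S e c En *; move=> HU tot par jo.
have [U1|U1] := leqP #|U| 1; first exact: orientable_le1.
have [/exists_inP[v vU lt]|big] := boolP [exists v in U, cut S e [set v] < 3 * k - 3].
  have H := split_vertex k_gt2 (col := col) vU.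
  apply: (H _ (#|S| + #|~: (set0 : {set 'I_(2 * k - 2)})|).+1 S e set0 c) => //.
  - by move=> S' e' c'; apply: (IH #|U :\ v|) => //; rewrite -En [X in _ < X](cardsD1 v) vU.
  - by move=> j; rewrite inE.
  have pos j : 0 < class_deg col S e v j.
    have [u uU uv] : exists2 u, u \in U & u \notin [set v].
      have /card_gt1P[a [b [aU bU ab]]] := U1.
      by have [E|] := eqVneq a v; [exists b; rewrite // inE -E eq_sym | exists a; rewrite ?inE].
    have [|i [iS Pi cr]] := jo j [set v] v u _ (set11 v) uU uv; first by rewrite sub1set.
    by rewrite /class_deg cut_card card_gt0; apply/set0Pn; exists i; rewrite !inE iS Pi cr.
  have le : \sum_(j in ~: (set0 : {set 'I_(2 * k - 2)})) class_deg col S e v j <= cut S e [set v].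
    by rewrite class_deg_sum; apply: leq_sum => i _; case: ifP.
  have eqs : \sum_(j in ~: (set0 : {set 'I_(2 * k - 2)})) class_deg col S e v j =
     \sum_(j in ~: (set0 : {set 'I_(2 * k - 2)})) (class_deg col S e v j).-1 + (2 * k - 2).
    transitivity (\sum_(j in ~: (set0 : {set 'I_(2 * k - 2)})) ((class_deg col S e v j).-1 + 1)).
      by apply: eq_bigr => j _; rewrite addn1 prednK.
    by rewrite big_split /= sum1_card setC0 cardsT card_ord.
  move: eqs le lt; move: (\sum_(_ in _) _) (\sum_(_ in _) _) (cut _ _ _) k_gt2; clear; lia.
apply: orientable_contract => // [_ v vU|B a sB aB /andP[B1 BU]].
  have [q ->] := par v vU; apply: good_large; rewrite leqNgt.
  by apply: contraNN big => lt; apply/exists_inP; exists v.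
apply: (IH _ _ _ _ _ _ erefl) => //.
- by rewrite -En; apply: collapse_card.
- exact: collapse_within.
- by rewrite collapse_csum_total.
- exact: collapse_parity.
- by move=> j; apply: collapse_joined.
Qed.

End TreeTheorem.

(** * Odd cuts *)

Section OddCuts.

Variables (T I : finType).
Implicit Types (S : {set I}) (e D : I -> T * T) (A B U X : {set T}).
Implicit Types (c : T -> int).

Definition odd_cuts l U S e :=
  [forall A : {set T}, (A \subset U) ==> odd (cut S e A) ==> (l <= cut S e A)].

Lemma odd_cutsP l U S e :
  reflect (forall A, A \subset U -> odd (cut S e A) -> l <= cut S e A) (odd_cuts l U S e).
Proof.
apply: (iffP forallP) => H A; first by move=> sA oA; have := H A; rewrite sA oA.
by apply/implyP => sA; apply/implyP; apply: H.
Qed.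

Lemma cut_setUI S e A B : exists t,
  cut S e A + cut S e B = cut S e (A :&: B) + cut S e (A :|: B) + 2 * t.
Proof.
exists (\sum_(i in S) (crosses A (e i) && crosses B (e i) &&
   ~~ (crosses (A :&: B) (e i)) && ~~ (crosses (A :|: B) (e i)))).
rewrite big_distrr -!big_split; apply: eq_bigr => i _; rewrite /crosses !inE /=.
by case: ((e i).1 \in A); case: ((e i).1 \in B); case: ((e i).2 \in A); case: ((e i).2 \in B).
Qed.

Lemma cut_setDD S e A B :
  cut S e A + cut S e B = cut S e (A :\: B) + cut S e (B :\: A) +
    2 * \sum_(i in S) (crosses (A :&: B) (e i) && crosses (A :|: B) (e i)).
Proof.
rewrite big_distrr -!big_split; apply: eq_bigr => i _; rewrite /crosses !inE /=.
by case: ((e i).1 \in A); case: ((e i).1 \in B); case: ((e i).2 \in A); case: ((e i).2 \in B).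
Qed.

Lemma cut_setID S e A B : exists t,
  cut S e (A :\: B) + cut S e (A :&: B) = cut S e A + 2 * t.
Proof.
exists (\sum_(i in S) (crosses (A :&: B) (e i) && crosses (A :\: B) (e i))).
rewrite big_distrr -!big_split; apply: eq_bigr => i _; rewrite /crosses !inE /=.
by case: ((e i).1 \in A); case: ((e i).1 \in B); case: ((e i).2 \in A); case: ((e i).2 \in B).
Qed.

Lemma cut_setC U S e A : within U S e -> cut S e (U :\: A) = cut S e A.
Proof. by move=> HU; apply: eq_bigr => i /HU /andP[h1 h2]; rewrite (crosses_setC A h1 h2). Qed.

(* If no edge can be split off against i, every other edge at v ends in an odd cut
   of size l around x; these sets are closed under union, and adding v to the
   largest one gives an odd cut of size less than l. *)
Lemma odd_lift l U S e v i x : odd l -> within U S e -> v \in U -> i \in S ->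
  same_ends (e i) (v, x) -> x != v -> odd_cuts l U S e -> ~~ odd (cut S e [set v]) ->
  exists j y, [/\ j \in S, i != j, same_ends (e j) (v, y), y \in U &
    odd_cuts l U (S :\ j) (upd e i (x, y))].
Proof.
move=> ol HU vU iS ei xv /odd_cutsP oddc evv.
have memU i' x' : i' \in S -> same_ends (e i') (v, x') -> x' \in U.
  by move=> /HU /andP[h1 h2] /orP[] /eqP E; rewrite E in h1 h2.
pose P j y := [&& j \in S, i != j, same_ends (e j) (v, y) & odd_cuts l U (S :\ j) (upd e i (x, y))].
have [/existsP[j /existsP[y /and4P[jS ij ej oj]]]|none] := boolP [exists j, exists y, P j y].
  by exists j, y; split => //; apply: memU ej.
pose dang A := [&& A \subset U, v \notin A, x \in A & cut S e A == l].
have viol j y : j \in S -> i != j -> same_ends (e j) (v, y) -> exists2 A, dang A & y \in A.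
  move=> jS ij ej; have : ~~ odd_cuts l U (S :\ j) (upd e i (x, y)).
    by apply: contraNN none => oj; apply/existsP; exists j; apply/existsP; exists y; rewrite /P jS ij ej.
  rewrite negb_forall => /existsP[A]; rewrite !negb_imply -ltnNge => /and3P[sA oA lt].
  have := lift_cut A iS jS ij ei ej; set b := (_ && _) => EA.
  have bT : b.
    apply: contraLR lt => /negbTE b0; rewrite b0 muln0 addn0 in EA.
    by rewrite -leqNgt -EA; apply: oddc => //; rewrite EA.
  rewrite bT muln1 in EA; have oA' : odd (cut S e A) by rewrite EA oddD oA.
  have EAl : cut S e A = l.
    have := oddc A sA oA'; rewrite leq_eqVlt => /orP[/eqP //|l1].
    have l2 : cut S e A <= l.+1 by rewrite EA addn2.
    have E : cut S e A = l.+1 by apply/eqP; rewrite eqn_leq l2.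
    by move: oA'; rewrite E /= ol.
  move: bT; rewrite /b; have [vA|vA] := boolP (v \in A).
    move=> /andP[xA yA]; exists (U :\: A); last by rewrite inE (memU j y jS ej) andbT; case: (y \in A) yA.
    rewrite /dang subsetDl cut_setC // EAl eqxx !inE vA (memU i x iS ei) /=.
    by case: (x \in A) xA.
  move=> /andP[xA yA]; exists A; last by case: (y \in A) yA.
  by rewrite /dang sA vA EAl eqxx andbT; case: (x \in A) xA.
have crv : crosses [set v] (e i) by rewrite (same_ends_cross _ ei) /crosses !inE eqxx (negbTE xv).
have [j0 j0S /andP[ij0 crj0]] : exists2 j, j \in S & (i != j) && crosses [set v] (e j).
  apply/exists_inP; apply: contraNT evv => /exists_inPn no.
  rewrite /cut (big_setD1 i iS) /= crv big1 // => j; rewrite !inE => /andP[ji jS].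
  by have := no j jS; rewrite eq_sym ji; case: (crosses _ _).
have [y0 y0v ej0] := crosses1P crj0.
have [A0 dA0 _] := viol j0 y0 j0S ij0 ej0.
pose A := [arg max_(B > A0 | dang B) #|B|].
have [dA maxA] : dang A /\ forall B, dang B -> #|B| <= #|A| by rewrite /A; case: arg_maxnP.
have {dA} /and4P[sA vA xA /eqP cA] := dA.
have all_in j y : j \in S -> same_ends (e j) (v, y) -> y != v -> y \in A.
  move=> jS ej yv; have [E|ij] := eqVneq i j.
    by rewrite -E in ej; rewrite -(same_ends_inj xv ei ej).
  have [B /and4P[sB vB xB /eqP cB] yB] := viol j y jS ij ej.
  have sU : A :|: B \subset U by rewrite subUset sA sB.
  suff dU : dang (A :|: B).
    have : #|A :|: B| <= #|A| by apply: maxA.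
    move=> le; have /eqP E : A == A :|: B by rewrite eqEcard subsetUl.
    by rewrite E inE yB orbT.
  rewrite /dang sU !inE negb_or vA vB xA /=.
  have [t1 E1] := cut_setUI S e A B; rewrite cA cB in E1.
  have [oU|eU] := boolP (odd (cut S e (A :|: B))).
    have oI : odd (cut S e (A :&: B)).
      by have := congr1 odd E1; rewrite mul2n !oddD odd_double ol oU /=; case: (odd _).
    have := oddc _ sU oU.
    have := oddc (A :&: B) (subset_trans (subsetIl _ _) sA) oI.
    by move: (cut _ _ _) (cut _ _ _) E1; clear; lia.
  exfalso; have eI : ~~ odd (cut S e (A :&: B)).
    by have := congr1 odd E1; rewrite mul2n !oddD odd_double ol (negbTE eU) /=; case: (odd _).
  have [t2 E2] := cut_setID S e A B; have [t3 E3] := cut_setID S e B A.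
  have o1 : odd (cut S e (A :\: B)).
    by have := congr1 odd E2; rewrite mul2n cA !oddD odd_double ol (negbTE eI) /=; case: (odd _).
  have o2 : odd (cut S e (B :\: A)).
    by have := congr1 odd E3; rewrite mul2n cB setIC !oddD odd_double ol (negbTE eI) /=; case: (odd _).
  have := cut_setDD S e A B; rewrite cA cB.
  have := oddc (A :\: B) (subset_trans (subsetDl _ _) sA) o1.
  have := oddc (B :\: A) (subset_trans (subsetDl _ _) sB) o2.
  rewrite (big_setD1 i iS) /= !(same_ends_cross _ ei) /crosses !inE xA xB (negbTE vA) (negbTE vB) /=.
  by move: (cut _ _ _) (cut _ _ _) (\sum_(_ in _) _); clear; lia.
exfalso.
have Ev : cut S e A = cut S e (v |: A) + cut S e [set v].
  rewrite -big_split; apply: eq_bigr => j jS /=.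
  have [crj|ncrj] := boolP (crosses [set v] (e j)).
    have [y yv ej] := crosses1P crj.
    by rewrite !(same_ends_cross _ ej) /crosses !inE eqxx (negbTE vA) (negbTE yv) (all_in j y).
  move: ncrj vA; rewrite /crosses !inE; case: eqP => [->|_]; case: eqP => [->|_] //= _.
    by rewrite addbb.
  by rewrite addn0.
have v1 : 0 < cut S e [set v] by rewrite /cut (big_setD1 i iS) /= crv.
have : l <= cut S e (v |: A).
  apply: oddc; first by rewrite subUset sub1set vU.
  by have := congr1 odd Ev; rewrite cA ol oddD (negbTE evv) addbF => <-.
by move: Ev v1; rewrite cA; move: (cut _ _ _) (cut _ _ _); clear; lia.
Qed.

End OddCuts.

Section OddTheorem.

Variables (T I : finType) (k : nat).
Implicit Types (S : {set I}) (e D : I -> T * T) (A B U X : {set T}).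
Implicit Types (c : T -> int).

Definition balanced_target S e c A := cong k (csum c A) (k * cut S e A)%:Z.

Lemma balanced_set U S e c A : (forall v, v \in U -> balanced_target S e c [set v]) ->
  A \subset U -> balanced_target S e c A.
Proof.
move=> H sA; have [q Eq] : exists q : int, (csum (fun v => (cut S e [set v])%:Z) A =
    (cut S e A)%:Z + 2 * q)%R.
  by apply: (@parity_set _ _ U _ _ _ _ _ sA) => v _; exists 0%R; rewrite mulr0 addr0.
have [j Hj] : cong k (csum c A) (\sum_(v in A) k%:Z * (cut S e [set v])%:Z)%R.
  by apply: cong_sum => v /(subsetP sA) /H; rewrite /balanced_target csum1 PoszM.
exists (j + q)%R; rewrite Hj -mulr_sumr [X in (_ * X)%R]Eq; move: (cut _ _ _) => w; clear; lia.
Qed.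

Lemma good_balanced w x : odd k -> 2 < k -> cong k x (k * w)%:Z ->
  (odd w -> 3 * k - 2 <= w) -> (~~ odd w -> 2 * k - 2 <= w) -> good k k.-1 k.-1 w x.
Proof.
move=> ok k2 [j Hj] h1 h2; have Ek := odd_double_half k; rewrite ok in Ek.
have [ow|ew] := boolP (odd w).
  have := h1 ow; have Ew := odd_double_half w; rewrite ow in Ew.
  move: {h1 h2 ow ok} (w./2) (k./2) Ew Ek => h p Ew Ek w3.
  exists (h + p.+1), (h - p), (- (j + h%:Z))%R; split; lia.
have := h2 ew; have Ew := odd_double_half w; rewrite (negbTE ew) add0n in Ew.
move: {h1 h2 ew} (w./2) Ew => h Ew w2.
exists h, h, (- (j + h%:Z))%R; split; lia.
Qed.

Hypothesis k_odd : odd k.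
Hypothesis k_gt2 : 2 < k.

Lemma orientable_odd_cuts U S e c : within U S e -> odd_cuts (3 * k - 2) U S e ->
  (forall v, v \in U -> balanced_target S e c [set v]) -> orientable k U S e c.
Proof.
have ol : odd (3 * k - 2) by rewrite oddB ?oddM ?k_odd //; lia.
move En : (#|U| + #|S|) => n; elim/ltn_ind: n => n IH in U S e c En *; move=> HU oc bal.
have totU : cong k 0 (csum c U).
  have [j Hj] := balanced_set bal (subxx U); exists (- j)%R; rewrite Hj.
  rewrite [cut _ _ _]big1 ?muln0; first by clear; lia.
  by move=> i /HU /andP[h1 h2]; rewrite /crosses h1 h2.
have [U1|U1] := leqP #|U| 1; first exact: orientable_le1.
have [/exists_inP[v vU ev]|allodd] := boolP [exists v in U, ~~ odd (cut S e [set v])].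
  have [cv|cv] := posnP (cut S e [set v]).
    have loop := isolated_loop HU cv.
    have [D oD sD] : orientable k (U :\ v) (inner S e (U :\ v)) e c.
      apply: (IH (#|U :\ v| + #|inner S e (U :\ v)|)) => //.
      - rewrite -En [X in _ < X + _](cardsD1 v) vU ltnS leq_add2l.
        by apply/subset_leq_card/subsetP => i; rewrite inE => /andP[].
      - by move=> i; rewrite inE => /andP[].
      - apply/odd_cutsP => A sA; rewrite cut_inner // => oA.
        by apply: (odd_cutsP _ _ _ _ oc) => //; apply: subset_trans sA (subsetDl _ _).
      - move=> u; rewrite !inE => /andP[_ uU]; rewrite /balanced_target cut_inner //.
        exact: bal.
    have [D' [oD' nD']] := inner_orients loop oD; exists D' => // u uU; rewrite nD'.
    have [->|uv] := eqVneq u v; last by apply: sD; rewrite !inE uv.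
    have [j Hj] := bal v vU; rewrite cv muln0 csum1 in Hj.
    have Hq : (net (inner S e (U :\ v)) D [set v] = 0)%R.
      apply: big1 => i iI; have := oD i iI.
      move: iI; rewrite inE !in_setD1 /flux !inE => /and3P[_ /andP[h1 _] /andP[h2 _]].
      by case/orP => /eqP E; rewrite E /= in h1 h2; rewrite (negbTE h1) (negbTE h2).
    by exists (- j)%R; rewrite Hq Hj; clear; lia.
  move: cv; rewrite cut_card card_gt0 => /set0Pn[i]; rewrite inE => /andP[iS /crosses1P[x xv ei]].
  have [j [y [jS ij ej yU oc']]] := odd_lift ol HU vU iS ei xv oc ev.
  have xU : x \in U by have := HU i iS; case/orP: ei => /eqP -> /= /andP[].
  have [D oD sD] : orientable k U (S :\ j) (upd e i (x, y)) c; last first.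
    have [D' [oD' nD']] := lift_net iS jS ij ei ej oD.
    by exists D' => // u uU; rewrite nD'; apply: sD.
  apply: (IH (#|U| + #|S :\ j|)) => //.
  - by rewrite -En [X in _ < _ + X](cardsD1 j) jS ltn_add2l.
  - exact: upd_within.
  - move=> u /bal [q Hq]; have := lift_cut [set u] iS jS ij ei ej.
    move: (nat_of_bool _) => b Eb; exists (q + b%:Z)%R; move: Hq; rewrite Eb => ->.
    by move: (cut _ _ _) => w; clear; lia.
apply: orientable_contract => // [_ v vU|B a sB aB /andP[B1 BU]].
  rewrite -csum1; apply: good_balanced => //; first exact: bal.
    by apply: (odd_cutsP _ _ _ _ oc); rewrite sub1set.
  by move=> ev; exfalso; move/negP: allodd; apply; apply/exists_inP; exists v.
apply: (IH (#|a |: (U :\: B)| + #|S|)) => //.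
- by rewrite -En ltn_add2r; apply: collapse_card.
- exact: collapse_within.
- apply/odd_cutsP => A sA; rewrite (collapse_cut _ _ sA aB); apply: (odd_cutsP _ _ _ _ oc).
  have sU1 : a |: (U :\: B) \subset U by rewrite subUset sub1set (subsetP sB) // subsetDl.
  by case: ifP => _; rewrite ?subUset ?sB ?andbT (subset_trans sA).
- move=> v vU; rewrite /balanced_target (collapse_cut1 S e sB aB vU) csum1 /collapse_c.
  case: eqP vU => [_ _|/eqP va]; first exact: balanced_set sB.
  by rewrite !inE (negbTE va) -csum1 => /andP[_]; apply: bal.
Qed.

End OddTheorem.

(** * Equitable colourings *)

Lemma sum_squares_le x y X Y : x + y = X + Y -> x <= y.+1 -> y <= x.+1 ->
  x ^ 2 + y ^ 2 + (Y.+1 < X) <= X ^ 2 + Y ^ 2.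
Proof.
wlog xy : x y / x <= y.
  by move=> W E h1 h2; case/orP: (leq_total x y) => h; [|rewrite [x ^ 2 + _]addnC]; apply: W; lia.
move=> E _ h2; case/orP: (leq_total X Y) => XY.
  have -> : (Y.+1 < X) = false by apply/negbTE; rewrite -leqNgt; lia.
  have [f Ef] : exists f, x = X + f by exists (x - X); lia.
  have [g Eg] : exists g, y = x + g by exists (y - x); lia.
  have -> : Y = X + g + 2 * f by lia.
  by rewrite Eg Ef; nia.
have [f Ef] : exists f, x = Y + f by exists (x - Y); lia.
have [g Eg] : exists g, y = x + g by exists (y - x); lia.
have EX : X = Y + g + 2 * f by lia.
have [lt|le] := boolP (Y.+1 < X).
  have : 0 < f by lia.
  by rewrite EX Eg Ef; nia.
by rewrite EX Eg Ef; nia.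
Qed.

Section EquitableColouring.

Variables (T I : finType).
Implicit Types (S : {set I}) (e D : I -> T * T) (A B U : {set T}).

Lemma net_le_cut S e A :
  (net S e A <= (cut S e A)%:Z)%R /\ (- (cut S e A)%:Z <= net S e A)%R.
Proof.
rewrite /net /cut Posz_sum -sumrN; split; apply: ler_sum => i _; rewrite /flux /crosses;
  by case: (_ \in A); case: (_ \in A).
Qed.

Lemma balanced_orientation S e : exists2 D, orients S e D &
  forall v, (net S D [set v] <= 1)%R /\ (- 1 <= net S D [set v])%R.
Proof.
move En : #|S| => n; elim: n => [|n IH] in S e En *.
  exists e => [i _|v]; first by rewrite /same_ends eqxx.
  by move/cards0_eq: En => ->; rewrite /net big_set0.
have [/existsP[v lt]|small] := boolP [exists v, 1 < cut S e [set v]].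
  move: lt; rewrite cut_card => /card_gt1P[i [j []]]; rewrite !inE.
  move=> /andP[iS /crosses1P[x _ ei]] /andP[jS /crosses1P[y _ ej]] ij.
  have [|D oD sD] := IH (S :\ j) (upd e i (x, y)).
    by move: En; rewrite (cardsD1 j) jS => -[].
  have [D' [oD' nD']] := lift_net iS jS ij ei ej oD.
  by exists D' => // u; rewrite nD'.
exists e => [i _|v]; first by rewrite /same_ends eqxx.
have : cut S e [set v] <= 1.
  by rewrite leqNgt; apply: contraNN small => lt; apply/existsP; exists v.
by have [h1 h2] := net_le_cut S e [set v]; move: (cut _ _ _) (net _ _ _) h1 h2; clear; lia.
Qed.

Variables (k : nat) (W : {set T}).
Hypothesis k_gt0 : 0 < k.

Definition colour_deg S e (f : I -> 'I_k) (a : 'I_k) v := cut [set i in S | f i == a] e [set v].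

(* A colouring minimising the sum of the squared colour degrees works: two
   colours can be redistributed evenly by a balanced orientation. *)
Lemma equitable_colouring S e :
  (forall i, i \in S -> ((e i).1 \in W) && ((e i).2 \notin W)) ->
  exists f : {ffun I -> 'I_k},
    forall a b v, colour_deg S e f a v <= (colour_deg S e f b v).+1.
Proof.
move=> bip; pose a0 : 'I_k := Ordinal k_gt0.
pose Phi (f : {ffun I -> 'I_k}) := \sum_v \sum_a (colour_deg S e f a v) ^ 2.
pose f := [arg min_(g < [ffun=> a0] | true) Phi g].
have minf g : Phi f <= Phi g by rewrite /f; case: arg_minnP => // h _; apply.
exists f => a b v; rewrite leqNgt; apply/negP => lt.
have ab : a != b by apply: contraTneq lt => ->; rewrite -leqNgt leqnSn.
pose Sab := [set i in S | (f i == a) || (f i == b)].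
have [D oD bD] := balanced_orientation Sab e.
pose g : {ffun I -> 'I_k} := [ffun i => if i \in Sab then (if (D i).1 \in W then a else b) else f i].
have inSab i : i \in Sab -> (e i).1 \in W /\ (e i).2 \notin W.
  by rewrite inE => /andP[/bip /andP[]].
have classD (h : I -> 'I_k) u : (forall i, i \in S -> ((h i == a) || (h i == b)) = (i \in Sab)) ->
    colour_deg S e h a u + colour_deg S e h b u = cut Sab e [set u].
  move=> hS; rewrite /colour_deg /cut.
  rewrite (big_setID [set i in S | h i == a] (A := Sab)) /=; congr (_ + _); apply: eq_bigl => i.
    rewrite !inE; case: (boolP (i \in S)) => //= iS; have := hS i iS; rewrite inE iS /= => <-.
    by case: (h i == a); rewrite ?andbF.
  rewrite !inE; case: (boolP (i \in S)) => //= iS.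
  have := hS i iS; rewrite inE iS /= => <-.
  by have [->|] := eqVneq (h i) a; rewrite ?(negbTE ab) //= ?andbF.
have gS i : i \in S -> ((g i == a) || (g i == b)) = (i \in Sab).
  move=> iS; rewrite ffunE; case: ifP => [_|]; first by case: ifP; rewrite eqxx ?orbT.
  by rewrite inE iS.
have fS i : i \in S -> ((f i == a) || (f i == b)) = (i \in Sab) by move=> iS; rewrite inE iS.
have other c u : c != a -> c != b -> colour_deg S e g c u = colour_deg S e f c u.
  move=> ca cb; rewrite /colour_deg /cut; apply: eq_bigl => i; rewrite !inE ffunE.
  case: (boolP (i \in S)) => //= iS; case: ifP => // iI.
  have -> : (f i == c) = false.
    apply/negbTE; move: iI; rewrite inE iS /= => /orP[] /eqP ->; by rewrite eq_sym.
  by case: ifP => _; rewrite eq_sym ?(negbTE ca) ?(negbTE cb).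
have netg u : (net Sab D [set u] = if u \in W then (colour_deg S e g a u)%:Z - (colour_deg S e g b u)%:Z
    else (colour_deg S e g b u)%:Z - (colour_deg S e g a u)%:Z)%R.
  have cg c : c \in [set a; b] -> colour_deg S e g c u =
      \sum_(i in Sab) ((g i == c) && crosses [set u] (e i)).
    move=> cab; rewrite /colour_deg /cut (sum_subset (S := S)); last first.
      by apply/subsetP => i; rewrite inE => /andP[].
    rewrite (sum_subset (S' := Sab) (S := S)); last by apply/subsetP => i; rewrite inE => /andP[].
    apply: eq_bigr => i iS; rewrite -(gS i iS) inE iS /=.
    move: cab; rewrite !inE; have [->|gc] := eqVneq (g i) c; first by move=> ->.
    by move=> _; case: ifP.
  rewrite !cg ?inE ?eqxx ?orbT // !Posz_sum -!sumrB.
  case: ifP => uW; apply: eq_bigr => i iI; have [e1 e2] := inSab i iI; rewrite ffunE iI.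
    have ne : ((e i).2 == u) = false by apply: contraNF e2 => /eqP ->.
    case/orP: (oD i iI) => /eqP E; rewrite E /= in e1 e2 ne *.
      by rewrite /flux /crosses e1 /= !inE eqxx (negbTE ab) /= ne; case: (_ == u).
    by rewrite /flux /crosses (negbTE e2) /= !inE eqxx (eq_sym b a) (negbTE ab) /= ne; case: (_ == u).
  have ne : ((e i).1 == u) = false by apply: contraFF uW => /eqP <-.
  case/orP: (oD i iI) => /eqP E; rewrite E /= in e1 e2 ne *.
    by rewrite /flux /crosses e1 /= !inE eqxx (negbTE ab) /= ne; case: (_ == u).
  by rewrite /flux /crosses (negbTE e2) /= !inE eqxx (eq_sym b a) (negbTE ab) /= ne; case: (_ == u).
have step u : \sum_c (colour_deg S e g c u) ^ 2 + ((colour_deg S e f b u).+1 < colour_deg S e f a u)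
    <= \sum_c (colour_deg S e f c u) ^ 2.
  rewrite !(bigD1 (P := predT) a) //= !(bigD1 (P := [pred i | i != a]) b) /= 1?eq_sym //.
  have -> : \sum_(i | (i != a) && (i != b)) colour_deg S e g i u ^ 2 =
      \sum_(i | (i != a) && (i != b)) colour_deg S e f i u ^ 2.
    by apply: eq_bigr => c /andP[ca cb]; rewrite other.
  have [h1 h2] : colour_deg S e g a u <= (colour_deg S e g b u).+1 /\
      colour_deg S e g b u <= (colour_deg S e g a u).+1.
    have := bD u; rewrite netg; move: (colour_deg _ _ _ _ _) (colour_deg _ _ _ _ _).
    by clear; case: (u \in W); lia.
  have := sum_squares_le (etrans (classD g u gS) (esym (classD f u fS))) h1 h2.
  set s := \sum_(i | _) colour_deg S e f i u ^ 2; set t := nat_of_bool _.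
  by rewrite !addnA (addnAC _ s t) leq_add2r.
have : Phi g < Phi f.
  rewrite /Phi (bigD1 v) //= [X in _ < X](bigD1 v) //= -addSn leq_add //.
    by have := step v; rewrite lt addn1.
  by apply: leq_sum => u _; apply: leq_trans (step u); rewrite leq_addr.
by rewrite ltnNge minf.
Qed.

End EquitableColouring.

Lemma equal_parts k q (F : 'I_k -> nat) :
  (forall a b, F a <= (F b).+1) -> \sum_a F a = k * q -> forall a, F a = q.
Proof.
move=> H E a; have Ek : k = \sum_(b : 'I_k) 1 by rewrite sum1_card card_ord.
case: (ltngtP (F a) q) => // lt.
  suff : \sum_b F b < \sum_(b : 'I_k) q by rewrite sum_nat_const card_ord E ltnn.
  rewrite (bigD1 a) //= [X in _ < X](bigD1 a) //= -addSn leq_add //.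
  by apply: leq_sum => b _; have := H b a; lia.
suff : \sum_(b : 'I_k) q < \sum_b F b by rewrite sum_nat_const card_ord E ltnn.
rewrite (bigD1 a) //= [X in _ < X](bigD1 a) //= -addSn leq_add //.
by apply: leq_sum => b _; have := H a b; lia.
Qed.

Lemma card_index_lt (T : finType) (E : {set T}) n : n <= #|E| ->
  #|[set x in E | index x (enum E) < n]| = n.
Proof.
move=> nE; transitivity #|[set x in take n (enum E)]|.
  congr #|pred_of_set _|; apply/setP => x; rewrite !inE -mem_enum.
  case: (boolP (x \in enum E)) => xE; first by rewrite in_take.
  by apply/esym/negbTE; apply: contraNN xE; apply: mem_take.
rewrite cardsE (card_uniqP (take_uniq _ (enum_uniq _))) size_take -cardE.
by case: ltngtP nE.
Qed.

Section ArcColouring.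

Variables (T I : finType) (k : nat) (D : I -> T * T).
Hypothesis k_gt0 : 0 < k.

Definition arc_end (s : bool) i := if s then (D i).1 else (D i).2.
Definition arc_deg s v := \sum_i (arc_end s i == v).
Definition arc_class_deg (f : I -> 'I_k) s a v := \sum_i ((arc_end s i == v) && (f i == a)).

Hypothesis balanced : forall v, arc_deg true v = arc_deg false v %[mod k].

Let r v := arc_deg true v %% k.
Let rest s := [set i | index i (enum [set j | arc_end s j == arc_end s i]) < r (arc_end s i)].

Let rE s v : arc_deg s v %% k = r v.
Proof. by case: s => //; rewrite /r balanced. Qed.

Let card_rest s v : \sum_i ((arc_end s i == v) && (i \in rest s)) = r v.
Proof.
rewrite -[RHS](@card_index_lt _ [set j | arc_end s j == v]); last first.
  have -> : #|[set j | arc_end s j == v]| = arc_deg s v by rewrite -sum1dep_card big_mkcond.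
  by rewrite -(rE s) leq_mod.
rewrite -sum1dep_card [RHS]big_mkcond /=; apply: eq_bigr => i _; rewrite !inE.
by case: eqP => //= ->; case: ifP.
Qed.

(* A vertex v is split on each side into a node for a multiple of k arcs and a
   node for the remaining r v arcs; the k - r v dummy edges joining the two
   remainder nodes force both of these to see the same colours. *)
Let node : finType := (bool * T * bool)%type.
Let link : finType := (I + T * 'I_k)%type.
Let link_ends (p : link) : node * node :=
  match p with
  | inl i => ((true, arc_end true i, i \in rest true), (false, arc_end false i, i \in rest false))
  | inr vt => ((true, vt.1, true), (false, vt.1, true))
  end.
Let active := [set p : link | if p is inr vt then vt.2 < k - r vt.1 else true].

Let part (f : link -> 'I_k) s b a v :=
  \sum_i ((arc_end s i == v) && ((i \in rest s) == b) && (f (inl i) == a)).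
Let dummy (f : link -> 'I_k) a v :=
  \sum_(t < k) ((t < k - r v) && (f (inr (v, t)) == a)).

Let colour_degE f s v b a :
  colour_deg active link_ends f a (s, v, b) = part f s b a v + (if b then dummy f a v else 0).
Proof.
rewrite /colour_deg /cut big_mkcond big_sumType /=; congr (_ + _).
  apply: eq_bigr => i _; rewrite !inE /= /crosses /= !inE !xpair_eqE.
  by case: s; rewrite /= ?addbF; case: (_ == a); rewrite /= ?andbT ?andbF.
transitivity (\sum_(u : T) \sum_(t < k) ((t < k - r u) && (f (inr (u, t)) == a) && b && (u == v))).
  rewrite pair_bigA; apply: eq_bigr => [[u t]] _; rewrite !inE /= /crosses /= !inE !xpair_eqE.
  case: (_ < _) => //=; case: (_ == a) => //=.
  by case: s; case: b; rewrite /= ?andbT ?andbF ?addbF.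
rewrite (bigD1 v) //= [X in _ + X]big1 ?addn0; last first.
  by move=> u /negbTE uv; rewrite big1 // => t _; rewrite uv andbF.
case: b; last by rewrite big1 // => t _; rewrite andbF.
by apply: eq_bigr => t _; rewrite eqxx !andbT.
Qed.

Let sum_colour (P : pred I) (h : I -> 'I_k) : \sum_a \sum_i (P i && (h i == a)) = \sum_i P i.
Proof.
rewrite exchange_big; apply: eq_bigr => i _; rewrite (bigD1 (h i)) //= eqxx andbT.
by rewrite big1 ?addn0 // => a ah; rewrite eq_sym (negbTE ah) andbF.
Qed.

Let sum_dummy f v : \sum_a dummy f a v = k - r v.
Proof.
rewrite exchange_big /=.
transitivity (\sum_(t < k) (t < k - r v : nat)).
  apply: eq_bigr => t _; rewrite (bigD1 (f (inr (v, t)))) //= eqxx andbT.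
  by rewrite big1 ?addn0 // => a ah; rewrite eq_sym (negbTE ah) andbF.
by rewrite -big_mkcond /= (big_ord_narrow (leq_subr _ _)) /= sum1_card card_ord.
Qed.

Lemma arc_colouring : exists f : I -> 'I_k, forall a v, exists x : bool,
  [/\ forall s, arc_class_deg f s a v + x = (arc_deg s v %/ k).+1 &
      r v = 0 -> x].
Proof.
pose W := [set n : node | n.1.1].
have [|f fP] := equitable_colouring (W := W) k_gt0 (S := active) (e := link_ends).
  by case=> [i|vt] _; rewrite !inE.
have rk v : r v < k by rewrite ltn_pmod.
have cd s v b a : part f s b a v + (if b then dummy f a v else 0) =
    if b then 1 else arc_deg s v %/ k.
  rewrite -colour_degE; move: a; apply: equal_parts; first by move=> a a'; apply: fP.
  under eq_bigr do rewrite colour_degE.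
  rewrite big_split /= /part.
  rewrite (sum_colour (fun i => (arc_end s i == v) && ((i \in rest s) == b)) (fun i => f (inl i))).
  case: b.
    rewrite sum_dummy muln1 (eq_bigr (fun i => ((arc_end s i == v) && (i \in rest s)) : nat)).
      by rewrite card_rest subnKC // ltnW.
    by move=> i _; rewrite eqb_id.
  rewrite [X in _ + X]big1 // addn0.
  have : \sum_i ((arc_end s i == v) && ((i \in rest s) == false)) +
      \sum_i ((arc_end s i == v) && (i \in rest s)) = arc_deg s v.
    rewrite -big_split; apply: eq_bigr => i _ /=.
    by case: (_ == v); case: (_ \in _).
  by rewrite card_rest -(rE s) => E; have := divn_eq (arc_deg s v) k; lia.
exists (fun i => f (inl i)) => a v.
have h1 s : part f s true a v + dummy f a v = 1 := cd s v true a.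
have h0 s : part f s false a v = arc_deg s v %/ k by rewrite -(cd s v false a) addn0.
have x1 : dummy f a v <= 1 by rewrite -(h1 true) leq_addl.
exists (dummy f a v == 1).
have -> : nat_of_bool (dummy f a v == 1) = dummy f a v by case: (dummy f a v) x1 => [|[]].
split=> [s|r0].
  have -> : arc_class_deg (fun i => f (inl i)) s a v = part f s true a v + part f s false a v.
    rewrite -big_split; apply: eq_bigr => i _ /=.
    by case: (_ == v); case: (_ \in _); case: (_ == a).
  by rewrite addnAC h1 h0 add1n.
have : part f true true a v <= r v.
  rewrite -(card_rest true); apply: leq_sum => i _; rewrite eqb_id.
  by case: (_ == v); case: (_ \in _); case: (_ == a).
by rewrite r0 leqn0 => /eqP p0; have := h1 true; rewrite p0 add0n => ->.
Qed.

End ArcColouring.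

Lemma cut_setT_deg (G : mgraph) (A : {set vertex G}) :
  cut [set: edge G] (@ends G) A = cut_deg A.
Proof. by rewrite /cut_deg -sum1dep_card [RHS]big_mkcond; apply: eq_big => i; rewrite ?inE. Qed.

Lemma connected_joined (G : mgraph) (F : {set edge G}) P :
  connected (spanning_subgraph F) -> {subset F <= P} ->
  joined [set: vertex G] [set: edge G] (@ends G) P.
Proof.
move=> con sFP A u v _ uA _ vA.
have [/exists_inP[i iF cr]|none] := boolP [exists i in F, crosses A (ends i)].
  by exists i; rewrite inE; split => //; apply: sFP.
have cl : closed (@adjacent (spanning_subgraph F)) A.
  move=> x y /existsP[[i iF]] /= ji; apply/eqP.
  have := exists_inPn none i iF; rewrite /crosses.
  by case/orP: ji => /eqP /= ->; rewrite /=; case: (x \in A); case: (y \in A).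
by have := closed_connect cl (con u v); rewrite uA (negbTE vA).
Qed.

Lemma orientable_balanced_target (G : mgraph) k : 2 < k -> odd k ->
  odd_edge_connected (3 * k - 2) G \/ tree_connected (2 * k - 2) G ->
  exists2 D, orients [set: edge G] (@ends G) D &
    forall v, exists j : int, net [set: edge G] D [set v] = (j * k%:Z)%R.
Proof.
move=> k2 ok hG.
pose c (v : vertex G) := Posz (k * cut [set: edge G] (@ends G) [set v]).
have W : within [set: vertex G] [set: edge G] (@ends G) by move=> i _; rewrite !inE.
have bal v : v \in [set: vertex G] -> balanced_target k [set: edge G] (@ends G) c [set v].
  by move=> _; rewrite /balanced_target csum1; apply: cong_refl.
suff [D oD sD] : orientable k [set: vertex G] [set: edge G] (@ends G) c.
  exists D => // v; have [j ->] := sD v (in_setT v).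
  exists ((cut [set: edge G] (@ends G) [set v])%:Z + j * 2)%R; rewrite /c.
  by move: (cut _ _ _); clear; lia.
case: hG => [oc|[F [trF disF]]].
  apply: orientable_odd_cuts => //; apply/odd_cutsP => A _.
  by rewrite cut_setT_deg; apply: oc.
pose col e := [pick j | e \in F j].
apply: (orientable_joined k2 (col := col)) => //.
- have [j Hj] := balanced_set bal (subxx _); exists (- j)%R; rewrite Hj.
  rewrite [cut _ _ _]big1 ?muln0; first by clear; lia.
  by move=> i _; rewrite /crosses !inE.
- move=> v _; rewrite /c; move: (cut _ _ _) => w.
  have Ek := odd_double_half k; rewrite ok in Ek.
  by exists ((k./2)%:Z * w%:Z)%R; rewrite -{1}Ek; clear; lia.
- move=> j; have [con _] := trF j; apply: connected_joined con _ => e eF.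
  rewrite unfold_in /coloured /col; case: pickP => [j' ej'|/(_ j)]; last by rewrite eF.
  have [->|jj'] := eqVneq j' j; first by rewrite eqxx.
  have /pred0P/(_ e) := disF j' j jj'.
  by rewrite /= eF ej'.
Qed.

Lemma spanning_subgraph_deg (G : mgraph) (F : {set edge G}) D v :
  orients [set: edge G] (@ends G) D ->
  @deg (spanning_subgraph F) v =
  \sum_(i in F) (((D i).1 == v) + ((D i).2 == v)).
Proof.
move=> oD; rewrite /deg [RHS]big_sub; apply: eq_bigr => i _ /=.
by case/orP: (oD (val i) (in_setT _)) => /eqP -> //=; rewrite addnC.
Qed.

Lemma deg_bounds k q r (x : bool) d dv : odd k -> r < k -> (r = 0 -> x) ->
  dv = k * q + 2 * r -> d + 2 * x = q + 2 ->
  d = dv %[mod 2] /\ (`|d%:R - dv%:R / k%:R : rat| < 2)%R.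
Proof.
move=> ok rk rx Edv Ed; have Ek := odd_double_half k; rewrite ok in Ek; split.
  have E : dv = k./2.*2 * q + q + 2 * r by rewrite Edv -{1}Ek; lia.
  by move: (k./2) E => p; rewrite -muln2 mulnAC; move: (p * q) Ed rx; clear; case: x => s /=; lia.
have kp : (0 < k%:R :> rat)%R by rewrite ltr0n; lia.
have -> : (d%:R - dv%:R / k%:R = (d%:R * k%:R - dv%:R) / k%:R :> rat)%R.
  by rewrite mulrBl mulfK // gt_eqF.
have H1 : (dv%:R < d%:R * k%:R + 2 * k%:R :> rat)%R.
  by rewrite -natrM -natrM -natrD ltr_nat Edv; move: Ed rk; clear; case: x => /= Ed rk; nia.
have H2 : (d%:R * k%:R < dv%:R + 2 * k%:R :> rat)%R.
  rewrite -natrM -natrM -natrD ltr_nat Edv; move: Ed rk rx; clear.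
  case: x => /= Ed rk rx; first by nia.
  by have r0 : 0 < r by [rewrite lt0n; apply/eqP => /rx]; nia.
by rewrite ltr_norml ltr_pdivlMr // ltr_pdivrMr //; apply/andP; split; lra.
Qed.

Theorem theorem4p2 (k : nat) (k_gt0 : 0 < k) (k_odd : odd k) (G : mgraph)
    (hG : odd_edge_connected (3 * k - 2) G \/ tree_connected (2 * k - 2) G) :
  exists F : 'I_k -> {set edge G},
    edge_decomposition F /\
    forall (i : 'I_k) (v : vertex G),
      @deg (spanning_subgraph (F i)) v = @deg G v %[mod 2] /\
      (`| (@deg (spanning_subgraph (F i)) v)%:R
          - (@deg G v)%:R / k%:R : rat | < 2)%R.
Proof.
suff [D [oD balD]] : exists D, orients [set: edge G] (@ends G) D /\
    forall v, arc_deg D true v = arc_deg D false v %[mod k].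
  have [f fP] := arc_colouring k_gt0 balD.
  exists (fun i => [set e | f e == i]); split.
    split=> [i j ij|].
      rewrite disjoints_subset; apply/subsetP => e; rewrite !inE => /eqP ->.
      exact: ij.
    by apply/setP => e; rewrite inE; apply/bigcupP; exists (f e); rewrite // inE.
  move=> a v; have [x [hx rx]] := fP a v.
  have Ed : @deg G v = arc_deg D true v + arc_deg D false v.
    rewrite /arc_deg -big_split; apply: eq_bigr => e _ /=.
    by case/orP: (oD e (in_setT _)) => /eqP -> //=; rewrite addnC.
  have Ea : @deg (spanning_subgraph [set e | f e == a]) v =
      arc_class_deg D f true a v + arc_class_deg D f false a v.
    rewrite (spanning_subgraph_deg v oD) big_mkcond -big_split; apply: eq_bigr => e _ /=.
    by rewrite inE; case: (f e == a); rewrite ?andbT ?andbF.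
  apply: (@deg_bounds k (arc_deg D true v %/ k + arc_deg D false v %/ k)
    (arc_deg D true v %% k) x) => //.
  - by rewrite ltn_pmod.
  - rewrite Ed mulnDr mul2n -addnn {2}balD.
    have := divn_eq (arc_deg D true v) k; have := divn_eq (arc_deg D false v) k.
    by rewrite ![k * _]mulnC; lia.
  - by rewrite Ea; have := hx true; have := hx false; lia.
have [k1|k1] := leqP k 1.
  exists (@ends G); split => [e _|v]; first by rewrite /same_ends eqxx.
  have {}k1 : k = 1 by apply/eqP; rewrite eqn_leq k1.
  by move: (arc_deg _ _ _) (arc_deg _ _ _) => a b; rewrite k1 !modn1.
have k2 : 2 < k by move: k_odd k1; clear; case: k => [|[|[|]]].
have [D oD nD] := orientable_balanced_target k2 k_odd hG.
exists D; split => // v; have [j Ej] := nD v.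
have En : (net [set: edge G] D [set v] = (arc_deg D true v)%:Z - (arc_deg D false v)%:Z)%R.
  rewrite /net /arc_deg !Posz_sum -sumrB; apply: eq_big => e; rewrite ?inE // => _.
  by rewrite /flux !inE.
rewrite En in Ej; case: j Ej => j Ej.
  have -> : arc_deg D true v = j * k + arc_deg D false v by lia.
  by rewrite modnMDl.
have -> : arc_deg D false v = j.+1 * k + arc_deg D true v by lia.
by rewrite modnMDl.
Qed.
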